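(* Let $\mathbb{H}$ be a separable real Hilbert space, $X$ a regularly varying random element of $\mathbb{H}$, and $X_1,\dots,X_n$ independent copies of $X$. Let $1\le k\le n$ and let $t_{n,k}$ be the $1-k/n$ quantile of $\|X\|$. Let $C_{t_{n,k}}=\mathbb{E}[\Theta\otimes\Theta\mid\|X\|>t_{n,k}]$ with $\Theta=X/\|X\|$, and let $\widehat C_k=\frac1k\sum_{i=1}^k\Theta_{(i)}\otimes\Theta_{(i)}$, where $\Theta_{(i)}=X_{(i)}/\|X_{(i)}\|$ and $X_{(1)},\dots,X_{(n)}$ is the permutation of the sample with $\|X_{(1)}\|\ge\dots\ge\|X_{(n)}\|$. Let $\delta\in(0,1)$. With probability larger than $1-\delta$, $$\|\widehat C_k-C_{t_{n,k}}\|_{HS(\mathbb{H})}\le\frac{1+4\sqrt{\log(2/\delta)}+\sqrt{8\log(4/\delta)}}{\sqrt k}+\frac{8\log(2/\delta)+4\log(4/\delta)}{3k}.$$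
   Context: For $f,g\in\mathbb{H}$, $f\otimes g$ is the operator $h\mapsto\langle f,h\rangle g$. $HS(\mathbb{H})$ is the Hilbert space of Hilbert–Schmidt operators on $\mathbb{H}$ with norm $\|T\|_{HS(\mathbb{H})}=(\sum_i\|Te_i\|^2)^{1/2}$ for any orthonormal basis $(e_i)$; expectations of operators are Bochner integrals in $HS(\mathbb{H})$. Regular variation (standing assumption). Let $\mathbb{H}_0=\mathbb{H}\setminus\{0\}$; $M_0$ is the class of Borel measures on $\mathbb{H}_0$ finite on Borel sets bounded away from $0$, and $\mu_n\to\mu$ in $M_0$ if $\int f\,d\mu_n\to\int f\,d\mu$ for all bounded continuous $f:\mathbb{H}_0\to\mathbb{R}$ vanishing in a neighborhood of $0$. A measurable function $b$ is regularly varying with index $\rho$ if $b(tx)/b(t)\to x^\rho$ as $t\to\infty$ for every $x>0$. $X$ is regularly varying (with index $\alpha>0$) if there exist a nonzero $\mu\in M_0$ and a regularly varying function $b$ such that $b(n)\mathbb{P}(X\in n\,\cdot)\to\mu$ in $M_0$ as $n\to\infty$, where $\mu(tA)=t^{-\alpha}\mu(A)$ for all $t>0$ and Borel $A\subset\mathbb{H}_0$.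
   Formalization: The formal theorem also assumes P(‖X‖ > t_{n,k}) = k/n, automatic when the distribution function of ‖X‖ is continuous; if ‖X‖ has an atom at the quantile t_{n,k}, the claimed bound can fail. *)

(* Defs.v *)
From HB Require Import structures.
From mathcomp Require Import all_boot all_order all_algebra perm.
From mathcomp Require Import all_classical all_reals all_analysis.
Set Implicit Arguments.
Unset Strict Implicit.
Unset Printing Implicit Defensive.
Import Order.TTheory GRing.Theory Num.Theory.
Import numFieldNormedType.Exports.
Local Open Scope classical_set_scope.
Local Open Scope ring_scope.

(* A real Hilbert space is a completeNormedModType H over R : realType together
   with a positive definite symmetric form dot : {dot H for idfun} that induces
   the norm (is_inner_product dot). *)

Section HilbertSpaces.
Context {R : realType} {H : completeNormedModType R}.
Implicit Types (dot : {dot H for idfun}) (B : set H).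

Definition is_inner_product dot := forall x, dot x x = `|x| ^+ 2.

Definition separable_space (T : topologicalType) :=
  exists D : set T, countable D /\ dense D.

Definition linear_span B : set H :=
  [set x | exists (s : seq H) (c : H -> R),
     (forall e, e \in s -> B e) /\ x = \sum_(e <- s) c e *: e].

(* The basis is an unindexed set of vectors, so that finite and infinite
   dimension are treated alike. *)
Definition orthonormal_basis dot B :=
  (forall e e', B e -> B e' -> dot e e' = (e == e')%:R) /\
  dense (linear_span B).

Definition tensor dot (f g : H) : H -> H := fun h => dot f h *: g.

Definition hs_norm2 B (T : H -> H) : \bar R :=
  \esum_(e in B) (`|T e| ^+ 2)%:E.

(* Meaningful on HS_op B only: fine sends +oo to 0. *)
Definition hs_norm B (T : H -> H) : R := Num.sqrt (fine (hs_norm2 B T)).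

(* The space of Hilbert-Schmidt operators, as a linear subspace of the space
   H -> H of all maps. *)
Definition HS_op B : set (H -> H) :=
  [set T | [/\ linear T, continuous T & (hs_norm2 B T < +oo)%E]].

(* The value at 0 is 0 : 0^-1 = 0. *)
Definition angle (x : H) : H := `|x|^-1 *: x.

End HilbertSpaces.

(* Bochner integral over D of maps with values in the normed space (V, N), where
   V is a linear subspace of E and N : E -> R is a norm on V. *)
Section BochnerIntegral.
Context {d : measure_display} {T : measurableType d} {R : realType}.
Context {E : lmodType R}.
Variables (mu : {finite_measure set T -> \bar R}) (V : set E) (N : E -> R).
Implicit Types (D : set T) (f s : T -> E) (I : E).

Definition bochner_simple s :=
  [/\ finite_set (range s),
      forall v, measurable (s @^-1` [set v]) &
      forall w, V (s w)].

Definition simple_integral D s : E :=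
  \sum_(v \in range s) fine (mu (D `&` s @^-1` [set v])) *: v.

Definition is_bochner_integral D f I :=
  [/\ forall w, D w -> V (f w), V I &
    exists s : nat -> T -> E,
      [/\ forall m, bochner_simple (s m),
          forall m, measurable_fun D (fun w => N (f w - s m w)),
          (fun m => \int[mu]_(w in D) (N (f w - s m w))%:E)%E @ \oo
            --> 0%E &
          (fun m => N (simple_integral D (s m) - I)) @ \oo --> (0 : R)]].

(* 0 if f is not Bochner integrable over D. *)
Definition bochner_integral D f : E :=
  xget 0 [set I | is_bochner_integral D f I].

End BochnerIntegral.

Section BorelSets.
Context {R : realType} (H : completeNormedModType R).

Definition borel_space := g_sigma_algebraType (@open H).

End BorelSets.

Section RandomElements.
Context {d : measure_display} {T : measurableType d} {R : realType}.
Context {H : completeNormedModType R}.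
Variable P : probability T R.

Definition random_element (X : T -> H) :=
  measurable_fun [set: T] (X : T -> borel_space H).

Definition same_law (X Y : T -> H) :=
  forall A : set (borel_space H), measurable A ->
    P (X @^-1` A) = P (Y @^-1` A).

Definition mutually_independent (n : nat) (X_ : 'I_n -> T -> H) :=
  forall (J : {set 'I_n}) (A : 'I_n -> set (borel_space H)),
    (forall i, measurable (A i)) ->
    P (\bigcap_(i in [set` J]) (X_ i @^-1` A i)) =
    (\prod_(i in J) P (X_ i @^-1` A i))%E.

Definition independent_copies (X : T -> H) (n : nat) (X_ : 'I_n -> T -> H) :=
  [/\ forall i, random_element (X_ i),
      forall i, same_law (X_ i) X &
      mutually_independent X_].

(* Generalized inverse of the distribution function of Y. It is extended
   real-valued because the quantile of level 0 is -oo. *)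
Definition quantile (Y : T -> R) (p : R) : \bar R :=
  ereal_inf [set x%:E | x in
    [set x : R | (p%:E <= P [set w | (Y w <= x)%R])%E]].

End RandomElements.

Section RegularVariation.
Context {d : measure_display} {T : measurableType d} {R : realType}.
Context {H : completeNormedModType R}.

(* A Borel measure on H \ {0} is encoded by its extension to H that gives mass 0
   to {0}, and a continuous function on H \ {0} vanishing in a neighborhood of 0
   by its extension to H by 0, which is again continuous. *)

Definition in_M0 (mu : {measure set (borel_space H) -> \bar R}) :=
  mu [set (0 : H)] = 0%E /\
  forall A : set (borel_space H), measurable A ->
    (exists2 e : R, 0 < e & forall x : H, A x -> e <= `|x|) ->
    (mu A < +oo)%E.

Definition M0_test (f : H -> R) :=
  [/\ continuous f,
      exists M : R, forall x, `|f x| <= M &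
      exists2 e : R, 0 < e & forall x : H, `|x| < e -> f x = 0].

Definition M0_cvg (nu : nat -> set (borel_space H) -> \bar R)
    (mu : set (borel_space H) -> \bar R) :=
  forall f : H -> R, M0_test f ->
    (fun n => \int[nu n]_(x in [set: borel_space H]) (f x)%:E)%E @ \oo
      --> (\int[mu]_(x in [set: borel_space H]) (f x)%:E)%E.

Definition dilation (t : R) (A : set H) : set H := [set t *: x | x in A].

Definition homogeneous (alpha : R) (mu : set (borel_space H) -> \bar R) :=
  forall (t : R) (A : set (borel_space H)), 0 < t -> measurable A ->
    ~ A (0 : H) ->
    mu (dilation t A) = ((t `^ (- alpha))%:E * mu A)%E.

(* Positivity near +oo is part of the usual convention for regularly varying
   functions. *)
Definition regularly_varying_fun (b : R -> R) (rho : R) :=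
  [/\ measurable_fun (`]0, +oo[ : set R) b,
      \forall t \near +oo, 0 < b t &
      forall x : R, 0 < x -> (b (t * x) / b t) @[t --> +oo] --> x `^ rho].

Definition regularly_varying (P : probability T R) (X : T -> H) (alpha : R) :=
  exists (mu : {measure set (borel_space H) -> \bar R}) (b : R -> R),
    [/\ in_M0 mu,
        exists2 A : set (borel_space H), measurable A & mu A != 0%E,
        exists rho : R, regularly_varying_fun b rho,
        M0_cvg (fun n A =>
          ((b n%:R)%:E * P (X @^-1` dilation n%:R A))%E) mu &
        homogeneous alpha mu].

End RegularVariation.

Section CovarianceOperators.
Context {d : measure_display} {T : measurableType d} {R : realType}.
Context {H : completeNormedModType R}.
Variables (P : probability T R) (dot : {dot H for idfun}) (B : set H).

Definition exceedance (X : T -> H) (t : \bar R) : set T :=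
  [set w | (t < `|X w|%:E)%E].

Definition angular_covariance (X : T -> H) (t : \bar R) : H -> H :=
  (fine (P (exceedance X t)))^-1 *:
  bochner_integral P (HS_op B) (hs_norm B) (exceedance X t)
    (fun w => tensor dot (angle (X w)) (angle (X w))).

(* A random permutation sorting the sample by nonincreasing norm; ties are broken
   in an arbitrary measurable way. *)
Definition sorts_norms (n : nat) (X_ : 'I_n -> T -> H) (sigma : T -> 'S_n) :=
  (forall s : 'S_n, measurable (sigma @^-1` [set s])) /\
  forall w (i j : 'I_n), (i <= j)%N ->
    `|X_ (sigma w j) w| <= `|X_ (sigma w i) w|.

(* The summand of index i (counted from 0) is the one of the order statistic of
   rank i + 1. *)
Definition empirical_angular_covariance (n : nat) (X_ : 'I_n -> T -> H)
    (sigma : T -> 'S_n) (k : nat) (w : T) : H -> H :=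
  k%:R^-1 *: \sum_(i < n | (i < k)%N)
    tensor dot (angle (X_ (sigma w i) w)) (angle (X_ (sigma w i) w)).

End CovarianceOperators.

(* Main.v *)
Require Import Defs.
From HB Require Import structures.
From mathcomp Require Import all_boot all_order all_algebra perm.
From mathcomp Require Import all_classical all_reals all_analysis.
From mathcomp Require Import measurable_realfun ring lra.
Set Implicit Arguments.
Unset Strict Implicit.
Unset Printing Implicit Defensive.
Import Order.TTheory GRing.Theory Num.Theory.
Import numFieldNormedType.Exports.
Local Open Scope classical_set_scope.
Local Open Scope ring_scope.

(* Let E_i be the event |X_i| > t. The sum over the k largest observations and the
   sum over the exceedances differ by at most |N - k| unit tensors, N being the
   number of exceedances, and the sum of the tensors over the exceedances, minus
   its mean, is a sum of i.i.d. centered bounded vectors of a Hilbert space. Both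
   deviations are bounded through E cosh (lam * |S|), following Pinelis: since
   cosh (sqrt x) is convex, cosh |s + y| <= cosh |s| (e^|y| - |y|) + c <s, y>,
   where c depends only on s, so each centered increment costs a factor at most
   E (e^|y| - |y|). To avoid integration in a Hilbert space this is first done for
   finitely-valued approximations of the angles, where expectations are finite
   sums; those approximations also compute the Bochner integral. *)

(** * Convexity of the hyperbolic cosine of a square root *)

(** Operators stay plain maps [H -> H], and their Hilbert-Schmidt norm is a supremum over finite
    parts of the basis. The exponential bound is therefore proved for any semi-inner product,
    applied to the form truncated to finitely many basis vectors, and passed to the supremum, its
    constants being independent of the truncation. The constants come from e^b - b <= 1 + b^2 for 0
    <= b <= 3/2: a vector of norm at most 1 minus its mean has norm at most 2, hence [lam <= 3 / 4].
    A summand vanishes outside an event of probability k/n, so its second moment is at most k/n, and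
    both deviations satisfy E cosh (lam |S|) <= exp (lam^2 k). Then P (|S| > r) <= 2 exp (lam^2 k -
    lam r), and lam = sqrt (L / k) leads to thresholds of the form 2 sqrt (k L) + (4/3) L, the last
    term covering the case where this lam exceeds 3/4. The Bochner integral is a value chosen among
    the admissible ones, so identifying it with a limit of finite sums takes both existence and
    uniqueness. *)

Definition cosh {R : realType} (x : R) : R := (expR x + expR (- x)) / 2.
Definition sinh {R : realType} (x : R) : R := (expR x - expR (- x)) / 2.

Section HyperbolicInequalities.
Context {R : realType}.
Implicit Types a b g x y t : R.

Lemma cosh_ge1 x : 1 <= cosh x.
Proof.
have := expR_ge1Dx x; have := expR_ge1Dx (- x); rewrite /cosh; lra.
Qed.

Lemma cosh_ge0 x : 0 <= cosh x.
Proof. exact: le_trans ler01 (cosh_ge1 x). Qed.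

Lemma expR_le_cosh x : expR x <= 2 * cosh x.
Proof. by have := expR_ge0 (- x); rewrite /cosh; lra. Qed.

Lemma sinh_le_cosh x : sinh x <= cosh x.
Proof. by have := expR_ge0 (- x); rewrite /cosh /sinh; lra. Qed.

Lemma ler_cosh x y : 0 <= x -> x <= y -> cosh x <= cosh y.
Proof.
move=> x0 xy; rewrite /cosh ler_pM2r// -subr_ge0.
have -> : expR y + expR (- y) - (expR x + expR (- x)) =
    (expR y - expR x) * (1 - expR (- x) * expR (- y)).
  have := expRxMexpNx_1 x; have := expRxMexpNx_1 y.
  set p := expR y; set q := expR (- y); set u := expR x; set v := expR (- x).
  move=> pq uv.
  have -> : (p - u) * (1 - v * q) = p - u - v * (p * q) + (u * v) * q by ring.
  by rewrite pq uv; ring.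
rewrite mulr_ge0// subr_ge0 ?ler_expR// -expRD expR_le1; lra.
Qed.

Lemma continuous_cosh : continuous (@cosh R).
Proof.
move=> x; rewrite /cosh; apply: cvgMr_tmp; apply: cvgD.
  exact: continuous_expR.
apply: (@continuous_comp _ _ _ -%R expR); last exact: continuous_expR.
exact: opp_continuous.
Qed.

Lemma cvg_expR_series x : series (exp_coeff x) @ \oo --> expR x.
Proof. exact: is_cvg_series_exp_coeff. Qed.

Lemma exp_coeffDN x i :
  exp_coeff x i + exp_coeff (- x) i =
  (~~ odd i)%:R * (2 * (x ^+ 2) ^+ i./2 / i`!%:R).
Proof.
rewrite /exp_coeff -mulrDl exprNn -[(-1) ^+ i]signr_odd -exprM.
have := odd_double_half i; rewrite -mul2n.
case: (odd i) => /=; first by rewrite expr1 mulN1r subrr !mul0r.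
by rewrite add0n => ->; rewrite expr0 !mul1r mulr_natl mulr2n.
Qed.

Lemma exprn_convex t x y n : 0 <= t <= 1 -> 0 <= x -> 0 <= y ->
  ((1 - t) * x + t * y) ^+ n <= (1 - t) * x ^+ n + t * y ^+ n.
Proof.
move=> /andP[t0 t1] x0 y0; elim: n => [|n IH]; first by rewrite !expr0; lra.
have m0 : 0 <= (1 - t) * x + t * y.
  by rewrite addr_ge0// mulr_ge0// subr_ge0.
rewrite exprS (le_trans (ler_wpM2l m0 IH))// -subr_ge0.
(* What the induction leaves over is a product of two differences of the same sign, since powers
   increase on nonnegative reals. *)
rewrite [leRHS](_ : _ = (1 - t) * t * ((x - y) * (x ^+ n - y ^+ n))); last first.
  by rewrite !exprS; ring.
rewrite mulr_ge0//; first by rewrite mulr_ge0// subr_ge0.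
have [xy|/ltW yx] := leP x y.
  by rewrite mulr_le0// subr_le0// lerXn2r// nnegrE.
by rewrite mulr_ge0// subr_ge0// lerXn2r// nnegrE.
Qed.

(* [cosh (sqrt x)] is a power series in [x] with nonnegative coefficients. *)
Lemma cosh_sqrt_convex t x y : 0 <= t <= 1 -> 0 <= x -> 0 <= y ->
  cosh (Num.sqrt ((1 - t) * x + t * y)) <=
  (1 - t) * cosh (Num.sqrt x) + t * cosh (Num.sqrt y).
Proof.
move=> t01 x0 y0; have /andP[t0 t1] := t01.
have m0 : 0 <= (1 - t) * x + t * y.
  by rewrite addr_ge0// mulr_ge0// subr_ge0.
pose c (z : R) : nat -> R := fun n =>
  series (exp_coeff (Num.sqrt z)) n + series (exp_coeff (- Num.sqrt z)) n.
have cE z : c z @ \oo --> 2 * cosh (Num.sqrt z).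
  rewrite /cosh [2 * _]mulrC divfK//; apply: cvgD; exact: cvg_expR_series.
have cs z n : 0 <= z ->
    c z n = \sum_(0 <= i < n) (~~ odd i)%:R * (2 * z ^+ i./2 / i`!%:R).
  move=> z0; rewrite /c /series /= -[LHS]big_split/=; apply: eq_bigr => i _.
  by rewrite exp_coeffDN sqr_sqrtr.
rewrite -(@ler_pM2l _ 2)// mulrDr ![2 * (_ * cosh _)]mulrCA.
set F := leRHS.
have Fcvg : (fun n => (1 - t) * c x n + t * c y n) @ \oo --> F.
  by apply: cvgD; apply: cvgMl_tmp; exact: cE.
apply: ler_cvg_to (cE _) Fcvg _; apply: nearW => n.
rewrite !cs// !mulr_sumr -big_split/=; apply: ler_sum => i _.
have := exprn_convex i./2 t01 x0 y0.
set u := _ ^+ i./2; set v := x ^+ _; set w := y ^+ _ => uvw.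
rewrite [leRHS](_ : _ = (~~ odd i)%:R * (2 * ((1 - t) * v + t * w) / i`!%:R)).
  by rewrite ler_wpM2l// ler_wpM2r ?invr_ge0// ler_wpM2l.
by ring.
Qed.

End HyperbolicInequalities.

Section PinelisStep.
Context {R : realType}.
Implicit Types a b g x : R.

Lemma cosh0 : cosh (0 : R) = 1.
Proof. by rewrite /cosh oppr0 expR0; lra. Qed.

Lemma coshN x : cosh (- x) = cosh x.
Proof. by rewrite /cosh opprK addrC. Qed.

Lemma cosh_normr x : cosh `|x| = cosh x.
Proof. by have [_|_] := ger0P x; rewrite ?coshN. Qed.

Lemma ge_sinh x : 0 <= x -> x <= sinh x.
Proof.
move=> x0; pose f (y : R) := expR y - expR (- y) - 2 * y.
have fd (y : R) : is_derive y (1 : R) f (2 * cosh y - 2).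
  rewrite /f; apply: is_derive_eq; rewrite /cosh.
  by rewrite /GRing.scale/=; lra.
have fc : {within `[0, x], continuous f}.
  apply: continuous_subspaceT => y; apply: differentiable_continuous.
  by apply/derivable1_diffP; case: (fd y).
have [c _] := MVT_segment x0 (fun y _ => fd y) fc.
have := cosh_ge1 c; rewrite /f/= !subr0 oppr0 expR0 mulr0 subrr subr0 => c1 fx.
have : 0 <= (2 * cosh c - 2) * x by rewrite mulr_ge0//; lra.
by rewrite -fx /sinh; lra.
Qed.

(** Read [a] = |s|, [b] = |y|, [g] = <s, y>. The radicand |s + y|^2 is the convex combination of (a
    - b)^2 and (a + b)^2 with weight (1 + c) / 2 on the latter, where c = g / (a b), and convexity
    gives cosh a cosh b + c sinh a sinh b. Splitting sinh b as b + (sinh b - b), the part in b is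
    linear in g and is kept exactly, so that it can average out; the other part is at most cosh a
    (sinh b - b). *)
Lemma cosh_sqrt_le a b g : 0 <= a -> 0 <= b -> `|g| <= a * b ->
  cosh (Num.sqrt (a ^+ 2 + b ^+ 2 + 2 * g)) <=
  cosh a * (expR b - b) + sinh a / a * g.
Proof.
move=> a0 b0 gab; have expE : expR b = cosh b + sinh b by rewrite /cosh /sinh; lra.
(* For [a = 0] the coefficient [sinh a / a] is a division by zero, but [g] vanishes as well; what
   remains is [b <= sinh b]. *)
have [a00|an0] := eqVneq a 0.
  have g0 : g = 0 by apply/eqP; rewrite -normr_le0 (le_trans gab)// a00 mul0r.
  rewrite g0 a00 expr0n/= !mulr0 !addr0 add0r sqrtr_sqr ger0_norm// cosh0 mul1r.
  by have := ge_sinh b0; lra.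
have [b00|bn0] := eqVneq b 0.
  have g0 : g = 0 by apply/eqP; rewrite -normr_le0 (le_trans gab)// b00 mulr0.
  by rewrite g0 b00 expr0n/= !mulr0 !addr0 sqrtr_sqr ger0_norm// expR0 subr0 mulr1.
have {an0}ap : 0 < a by rewrite lt_neqAle eq_sym an0.
have {bn0}bp : 0 < b by rewrite lt_neqAle eq_sym bn0.
have abp : 0 < a * b by rewrite mulr_gt0.
set c := g / (a * b).
have cE : g = c * (a * b) by rewrite /c divfK// gt_eqF.
have c1 : `|c| <= 1 by rewrite /c normrM normfV (gtr0_norm abp) ler_pdivrMr// mul1r.
have t01 : 0 <= (1 + c) / 2 <= 1.
  by move: c1; rewrite ler_norml => /andP[c1 c2]; apply/andP; split; lra.
have := cosh_sqrt_convex t01 (sqr_ge0 (a - b)) (sqr_ge0 (a + b)).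
rewrite !sqrtr_sqr !cosh_normr.
have -> : (1 - (1 + c) / 2) * (a - b) ^+ 2 + (1 + c) / 2 * (a + b) ^+ 2 =
    a ^+ 2 + b ^+ 2 + 2 * g by rewrite cE; field.
move=> /le_trans; apply.
have -> : (1 - (1 + c) / 2) * cosh (a - b) + (1 + c) / 2 * cosh (a + b) =
    cosh a * cosh b + c * (sinh a * sinh b).
  by rewrite /cosh /sinh !opprD !opprK !expRD; field.
have -> : sinh a / a * g = sinh a * (c * b).
  by rewrite cE; field; rewrite gt_eqF.
have sb := ge_sinh b0; have sa := le_trans a0 (ge_sinh a0).
have h1 : sinh a * (c * (sinh b - b)) <= sinh a * (sinh b - b).
  rewrite ler_wpM2l// ler_piMl ?subr_ge0//.
  by apply: le_trans c1; exact: ler_norm.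
have h2 : sinh a * (sinh b - b) <= cosh a * (sinh b - b).
  by rewrite ler_wpM2r ?sinh_le_cosh// subr_ge0.
rewrite expE; have := le_trans h1 h2.
set u := cosh a; set v := sinh a; set p := cosh b; set q := sinh b => h.
have -> : u * p + c * (v * q) = u * p + v * (c * (q - b)) + v * (c * b) by ring.
have -> : u * (p + q - b) = u * p + u * (q - b) by ring.
by rewrite lerD2r lerD2l.
Qed.

(* For [i >= 2] the term [b^i / i!] is at most [b^2 / 2 * (b / 3)^(i-2)]. *)
Lemma expR_le_quadratic b : 0 <= b <= 3 / 2 -> expR b <= 1 + b + b ^+ 2.
Proof.
move=> /andP[b0 b1]; apply: (cvgr_to_le (@cvg_expR_series _ b)).
have cle i : exp_coeff b i.+2 <= b ^+ 2 * 2^-1 ^+ i.+1.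
  elim: i => [|i IH]; first by rewrite /exp_coeff/= expr1.
  rewrite [exp_coeff _ _](_ : _ = exp_coeff b i.+2 * (b / i.+3%:R)); last first.
    rewrite /exp_coeff/= [b ^+ i.+3]exprS [i.+3`!]factS natrM.
    by rewrite invfM mulrACA mulrC.
  rewrite [2^-1 ^+ i.+2]exprSr [leRHS]mulrA ler_pM ?divr_ge0//.
    by rewrite exprn_ge0.
  rewrite ler_pdivrMr//; apply: le_trans b1 _.
  have : (3 : R) <= i.+3%:R by rewrite ler_nat.
  by lra.
have ple n : \sum_(0 <= i < n) exp_coeff b i.+2 <= b ^+ 2 * (1 - 2^-1 ^+ n).
  elim: n => [|n IH]; first by rewrite big_geq// expr0 subrr mulr0.
  rewrite big_nat_recr//= (le_trans (lerD IH (cle n)))// -mulrDr ler_wpM2l ?sqr_ge0//.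
  by rewrite exprS; lra.
exists 2%N => // -[//|[//|n _]]; rewrite /series /= big_nat_recl// big_nat_recl//.
rewrite /exp_coeff /= expr0 expr1 fact0 !invr1 !mulr1.
by rewrite addrA lerD2l (le_trans (ple n))// ler_piMr ?sqr_ge0.
Qed.

End PinelisStep.

(** * Exponential moments in semi-inner product spaces *)

Section SemiInnerProducts.
Context {R : realType} {E : lmodType R}.
Implicit Types (ip : E -> E -> R) (x y z : E).

(** Only semidefinite, because the main instance is the Hilbert-Schmidt form seen on finitely many
    basis vectors, which can vanish on nonzero maps. *)
Definition semi_inner_product ip :=
  [/\ forall x y, ip x y = ip y x,
      forall a x y z, ip (a *: x + y) z = a * ip x z + ip y z &
      forall x, 0 <= ip x x].

Definition seminorm ip x := Num.sqrt (ip x x).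

Variable ip : E -> E -> R.
Hypothesis hip : semi_inner_product ip.
Local Notation nrm := (seminorm ip).

Lemma ipC x y : ip x y = ip y x. Proof. by case: hip. Qed.

Lemma ipPl a x y z : ip (a *: x + y) z = a * ip x z + ip y z.
Proof. by case: hip. Qed.

Lemma ip_ge0 x : 0 <= ip x x. Proof. by case: hip. Qed.

Lemma ipDl x y z : ip (x + y) z = ip x z + ip y z.
Proof. by rewrite -[x in LHS]scale1r ipPl mul1r. Qed.

Lemma ip0l z : ip 0 z = 0.
Proof. by apply: (addrI (ip 0 z)); rewrite -ipDl !addr0. Qed.

Lemma ipZl a x z : ip (a *: x) z = a * ip x z.
Proof. by rewrite -[_ *: _]addr0 ipPl ip0l addr0. Qed.

Lemma ipDr x y z : ip z (x + y) = ip z x + ip z y.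
Proof. by rewrite ipC ipDl !(ipC z). Qed.

Lemma ipZr a x z : ip z (a *: x) = a * ip z x.
Proof. by rewrite ipC ipZl ipC. Qed.

Lemma ip_sumr (I : Type) (r : seq I) (P : pred I) (f : I -> E) z :
  ip z (\sum_(i <- r | P i) f i) = \sum_(i <- r | P i) ip z (f i).
Proof.
by apply: big_morph => [x y|]; [exact: ipDr|rewrite ipC ip0l].
Qed.

Lemma seminorm_ge0 x : 0 <= nrm x. Proof. exact: sqrtr_ge0. Qed.

Lemma seminorm0 : nrm 0 = 0. Proof. by rewrite /seminorm ip0l sqrtr0. Qed.

Lemma sqr_seminorm x : nrm x ^+ 2 = ip x x.
Proof. by rewrite sqr_sqrtr// ip_ge0. Qed.

Lemma seminormZ a x : nrm (a *: x) = `|a| * nrm x.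
Proof.
by rewrite /seminorm ipZl ipZr mulrA -expr2 sqrtrM ?sqr_ge0// sqrtr_sqr.
Qed.

Lemma seminormN x : nrm (- x) = nrm x.
Proof. by rewrite -scaleN1r seminormZ normrN1 mul1r. Qed.

Lemma sqr_seminormD x y : nrm (x + y) ^+ 2 = nrm x ^+ 2 + nrm y ^+ 2 + 2 * ip x y.
Proof. by rewrite !sqr_seminorm !ipDl !ipDr (ipC y x); ring. Qed.

Lemma ip_cauchy_schwarz x y : `|ip x y| <= nrm x * nrm y.
Proof.
have quad t : 0 <= nrm x ^+ 2 + 2 * t * ip x y + t ^+ 2 * nrm y ^+ 2.
  have := sqr_ge0 (nrm (x + t *: y)); rewrite sqr_seminormD seminormZ ipZr.
  by rewrite exprMn -normrX ger0_norm ?sqr_ge0//; lra.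
have [y0|yn0] := eqVneq (nrm y) 0.
  rewrite y0 mulr0 normr_le0; apply: contraT => g0.
  (* Here the quadratic is affine in [t], with slope [2 * ip x y]; at this [t] it would equal -1. *)
  have := quad (- (nrm x ^+ 2 + 1) / (2 * ip x y)); rewrite y0.
  suff -> : 2 * (- (nrm x ^+ 2 + 1) / (2 * ip x y)) * ip x y = - (nrm x ^+ 2 + 1).
    by lra.
  by field.
rewrite -ler_sqr ?nnegrE ?mulr_ge0 ?seminorm_ge0// -normrX ger0_norm ?sqr_ge0//.
have := quad (- ip x y / nrm y ^+ 2); set g := ip x y; set a := nrm x.
set b := nrm y => h; rewrite exprMn -ler_pdivrMr; last first.
  by rewrite exprn_gt0// lt_neqAle eq_sym yn0 seminorm_ge0.
rewrite -subr_ge0; apply: le_trans h _; rewrite le_eqVlt; apply/orP; left.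
by apply/eqP; field.
Qed.

Lemma ler_seminormD x y : nrm (x + y) <= nrm x + nrm y.
Proof.
rewrite -ler_sqr ?nnegrE ?addr_ge0 ?seminorm_ge0// sqr_seminormD.
by have := le_trans (ler_norm _) (ip_cauchy_schwarz x y); rewrite sqrrD; lra.
Qed.

Lemma ler_seminormB x y : nrm (x - y) <= nrm x + nrm y.
Proof. by rewrite (le_trans (ler_seminormD _ _))// seminormN. Qed.

Lemma ler_seminorm_sum (I : Type) (r : seq I) (P : pred I) (f : I -> E) :
  nrm (\sum_(i <- r | P i) f i) <= \sum_(i <- r | P i) nrm (f i).
Proof.
elim/big_ind2 : _ => [|x a y b xa yb|//]; first by rewrite seminorm0.
by rewrite (le_trans (ler_seminormD _ _))// lerD.
Qed.

End SemiInnerProducts.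

Lemma ord0_false (i : 'I_0) : False.
Proof. by case: i. Qed.

Section FiniteFunctions.
Context {F : finType} {n : nat}.

Definition ffun_cons (v : F) (f : {ffun 'I_n -> F}) : {ffun 'I_n.+1 -> F} :=
  [ffun i => if unlift ord0 i is Some j then f j else v].

Lemma ffun_cons0 v f : ffun_cons v f ord0 = v.
Proof. by rewrite ffunE unlift_none. Qed.

Lemma ffun_consS v f j : ffun_cons v f (lift ord0 j) = f j.
Proof. by rewrite ffunE liftK. Qed.

(** Fubini for a finite product: this isolates the first draw in the induction of [pinelis]. *)
Lemma big_ffun_cons {R : nmodType} (G : {ffun 'I_n.+1 -> F} -> R) :
  \sum_f G f = \sum_v \sum_f G (ffun_cons v f).
Proof.
rewrite pair_bigA/= (reindex (fun vf => ffun_cons vf.1 vf.2))//.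
exists (fun g : {ffun 'I_n.+1 -> F} => (g ord0, [ffun j : 'I_n => g (lift ord0 j)])) => [[v f] _|g _] /=.
  by congr pair; [rewrite ffun_cons0|apply/ffunP => j; rewrite ffunE ffun_consS].
apply/ffunP => i; rewrite ffunE.
by case: unliftP => [j ->|->]; rewrite ?ffunE.
Qed.

End FiniteFunctions.

Section Pinelis.
Context {R : realType} {E : lmodType R} {F : finType}.
Variables (ip : E -> E -> R) (p : F -> R).
Hypothesis hip : semi_inner_product ip.
Hypothesis p_ge0 : forall v, 0 <= p v.
Hypothesis p_sum1 : \sum_v p v = 1.
Local Notation nrm := (seminorm ip).

(** [p] is the law of the increment. Centering cancels the term linear in [y v]; the rest is at most
    cosh |s| times the mean of 1 + |y|^2, and 1 + x <= e^x. *)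
Lemma pinelis_step (y : F -> E) (s : E) :
    \sum_v p v *: y v = 0 -> (forall v, nrm (y v) <= 3 / 2) ->
  \sum_v p v * cosh (nrm (s + y v)) <=
  cosh (nrm s) * expR (\sum_v p v * nrm (y v) ^+ 2).
Proof.
move=> y0 ybnd; set k := sinh (nrm s) / nrm s.
have stepv v : p v * cosh (nrm (s + y v)) <= cosh (nrm s) *
    (p v * (1 + nrm (y v) ^+ 2)) + k * (p v * ip s (y v)).
  have -> a b c : a * (p v * b) + k * (p v * c) = p v * (a * b + k * c) by ring.
  rewrite ler_wpM2l//.
  rewrite -[nrm (s + y v)]ger0_norm ?seminorm_ge0// -sqrtr_sqr.
  rewrite (sqr_seminormD hip).
  apply: le_trans (cosh_sqrt_le _ _ (ip_cauchy_schwarz hip _ _)) _;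
    rewrite ?seminorm_ge0// lerD2r ler_wpM2l ?cosh_ge0//.
  have := @expR_le_quadratic _ (nrm (y v)); rewrite seminorm_ge0 ybnd => /(_ isT).
  lra.
apply: le_trans (ler_sum _ (fun v _ => stepv v)) _; rewrite big_split/= -!mulr_sumr.
have -> : \sum_v p v * ip s (y v) = 0.
  transitivity (ip s (\sum_v p v *: y v)); last by rewrite y0 ipC ?ip0l.
  by rewrite ip_sumr//; apply: eq_bigr => v _; rewrite ipZr.
rewrite mulr0 addr0 ler_wpM2l ?cosh_ge0//.
rewrite [leLHS](eq_bigr (fun v => p v + p v * nrm (y v) ^+ 2)); last first.
  by move=> v _; rewrite mulrDr mulr1.
by rewrite big_split/= p_sum1 expR_ge1Dx.
Qed.

(** The weighted sum over [f] is the expectation over [n] independent draws from [p]. The starting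
    point [s] is arbitrary so that the induction can absorb the first draw into it. *)
Lemma pinelis (n : nat) (y : F -> E) (s : E) :
    \sum_v p v *: y v = 0 -> (forall v, nrm (y v) <= 3 / 2) ->
  \sum_(f : {ffun 'I_n -> F}) (\prod_i p (f i)) * cosh (nrm (s + \sum_i y (f i))) <=
  cosh (nrm s) * expR (n%:R * \sum_v p v * nrm (y v) ^+ 2).
Proof.
move=> y0 ybnd; elim: n s => [|n IH] s.
  rewrite (big_pred1 (finfun (fun i : 'I_0 => False_rect F (ord0_false i)))).
    by rewrite !big_ord0 addr0 mul1r mul0r expR0 mulr1.
  by move=> f; apply/esym/eqP/ffunP => -[].
rewrite big_ffun_cons -[n.+1%:R]natr1 mulrDl mul1r expRD.
set q := \sum_v _ * _ ^+ 2.
have inner v : \sum_(f : {ffun 'I_n -> F}) (\prod_i p (ffun_cons v f i)) *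
      cosh (nrm (s + \sum_i y (ffun_cons v f i))) <=
    p v * cosh (nrm (s + y v)) * expR (n%:R * q).
  rewrite -[leRHS]mulrA; apply: le_trans _ (ler_wpM2l (p_ge0 v) (IH (s + y v))).
  rewrite mulr_sumr le_eqVlt; apply/orP; left; apply/eqP; apply: eq_bigr => f _.
  rewrite !big_ord_recl !ffun_cons0 addrA [RHS]mulrA.
  congr (_ * _ * cosh (nrm (_ + _))); apply: eq_bigr => i _;
    by rewrite ffun_consS.
apply: le_trans (ler_sum _ (fun v _ => inner v)) _.
rewrite -mulr_suml [expR _ * expR _]mulrC mulrA ler_wpM2r ?expR_ge0//.
exact: pinelis_step.
Qed.

(** Centering turns norms at most 1 into norms at most 2, so [lam <= 3 / 4] keeps the scaled
    increments within 3/2. It can only decrease the second moment: E |z - m|^2 = E |z|^2 - |m|^2. *)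
Lemma pinelis_centered (n : nat) (z : F -> E) (lam : R) :
    (forall v, nrm (z v) <= 1) -> 0 <= lam <= 3 / 4 ->
  \sum_(f : {ffun 'I_n -> F}) (\prod_i p (f i)) *
     cosh (lam * nrm (\sum_i z (f i) - n%:R *: \sum_v p v *: z v)) <=
  expR (n%:R * (lam ^+ 2 * \sum_v p v * nrm (z v) ^+ 2)).
Proof.
move=> z1 /andP[l0 l1]; set m := \sum_v p v *: z v.
have m1 : nrm m <= 1.
  rewrite (le_trans (ler_seminorm_sum hip _ _ _))// -p_sum1 ler_sum// => v _.
  by rewrite seminormZ// ger0_norm// ler_piMr.
pose y v := lam *: (z v - m).
have y0 : \sum_v p v *: y v = 0.
  rewrite (eq_bigr (fun v => lam *: (p v *: z v - p v *: m))); last first.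
    by move=> v _; rewrite /y scalerA mulrC -scalerA scalerBr.
  by rewrite -scaler_sumr sumrB -scaler_suml p_sum1 scale1r subrr scaler0.
have yE v : nrm (y v) = lam * nrm (z v - m) by rewrite seminormZ// ger0_norm.
have y1 v : nrm (y v) <= 3 / 2.
  have := le_trans (ler_seminormB hip (z v) m) (lerD (z1 v) m1).
  rewrite yE => h; apply: le_trans (ler_wpM2l l0 h) _; lra.
have := pinelis n 0 y0 y1; rewrite seminorm0// cosh0 mul1r.
have -> : \sum_(f : {ffun 'I_n -> F}) (\prod_i p (f i)) * cosh (nrm (0 + \sum_i y (f i)))
    = \sum_(f : {ffun 'I_n -> F}) (\prod_i p (f i)) *
      cosh (lam * nrm (\sum_i z (f i) - n%:R *: m)).
  apply: eq_bigr => f _; congr (_ * cosh _).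
  rewrite add0r /y -scaler_sumr seminormZ// ger0_norm//; congr (_ * nrm _).
  by rewrite sumrB sumr_const card_ord scaler_nat.
move=> /le_trans; apply; rewrite ler_expR ler_wpM2l// mulr_sumr.
rewrite [leLHS](eq_bigr (fun v => lam ^+ 2 * (p v * (nrm (z v) ^+ 2 + nrm m ^+ 2)
   - 2 * (p v * ip m (z v))))); last first.
  move=> v _; rewrite yE exprMn sqr_seminormD// seminormN//.
  by rewrite -[- m]scaleN1r (ipZr hip) (ipC hip (z v)); ring.
rewrite -!mulr_sumr ler_wpM2l ?sqr_ge0// sumrB -mulr_sumr.
rewrite (eq_bigr (fun v => p v * nrm (z v) ^+ 2 + p v * nrm m ^+ 2)); last first.
  by move=> v _; rewrite mulrDr.
rewrite big_split/= -mulr_suml p_sum1 mul1r.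
have -> : \sum_v p v * ip m (z v) = nrm m ^+ 2.
  rewrite sqr_seminorm// [in RHS]/m ip_sumr//.
  by apply: eq_bigr => v _; rewrite ipZr.
by have := sqr_ge0 (nrm m); lra.
Qed.

End Pinelis.

(** * Hilbert-Schmidt norms *)

Section HilbertSchmidtNorm.
Context {R : realType} {H : completeNormedModType R}.
Variables (dot : {dot H for idfun}) (B : set H).
Hypothesis hdot : is_inner_product dot.
Hypothesis hB : orthonormal_basis dot B.
Implicit Types (T S : H -> H) (r : seq H) (f g h : H).

Lemma dot_semi_inner_product : semi_inner_product dot.
Proof.
split=> [x y|a x y z|x]; last by rewrite hdot sqr_ge0.
  by rewrite hermC expr0 mul1r.
by rewrite linearPl.
Qed.
Local Notation hd := dot_semi_inner_product.

Lemma seminorm_dot x : seminorm dot x = `|x|.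
Proof. by rewrite /seminorm hdot sqrtr_sqr normr_id. Qed.

Lemma dot_cauchy_schwarz x y : `|dot x y| <= `|x| * `|y|.
Proof. by rewrite -!seminorm_dot ip_cauchy_schwarz//; exact: hd. Qed.

Lemma dot_continuous f : continuous (dot f : H -> R).
Proof.
have -> : (dot f : H -> R) = (fun x => 2^-1 * (`|f + x| ^+ 2 - `|f| ^+ 2 - `|x| ^+ 2)).
  by apply/funext => x; rewrite -!hdot !(ipDl hd) !(ipDr hd) (ipC hd x f); field.
move=> x; apply: cvgMl_tmp.
have nc (g : H -> H) : g @ x --> g x -> (fun y => `|g y| ^+ 2) @ x --> `|g x| ^+ 2.
  by move=> gx; rewrite expr2; apply: cvgM; apply: cvg_norm.
apply: cvgB; last by apply: (nc id); exact: cvg_id.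
apply: cvgB; last exact: cvg_cst.
by apply: (nc (fun y => f + y)); apply: cvgD; [exact: cvg_cst|exact: cvg_id].
Qed.

(** The Hilbert-Schmidt inner product cut down to a finite list of vectors. It makes sense for all
    maps, so the exponential bound applies to it with no question of convergence. *)
Definition hs_ip r T S := \sum_(e <- r) dot (T e) (S e).

Lemma hs_ip_semi_inner_product r : semi_inner_product (hs_ip r).
Proof.
split=> [T S|a T S U|T].
- by apply: eq_bigr => e _; rewrite (ipC hd).
- rewrite /hs_ip mulr_sumr -big_split/=; apply: eq_bigr => e _.
  by rewrite (ipDl hd) (ipZl hd).
- by apply: sumr_ge0 => e _; rewrite hdot sqr_ge0.
Qed.
Local Notation hr := hs_ip_semi_inner_product.

Definition hs_seminorm r T := seminorm (hs_ip r) T.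

Lemma sqr_hs_seminorm r T : hs_seminorm r T ^+ 2 = \sum_(e <- r) `|T e| ^+ 2.
Proof. by rewrite sqr_seminorm//; [apply: eq_bigr => e _; exact: hdot|exact: hr]. Qed.

Definition finite_part r := uniq r /\ forall e, e \in r -> B e.

Definition hs_finite T := (hs_norm2 B T < +oo)%E.

Lemma hs_norm2_ge0 T : (0 <= hs_norm2 B T)%E.
Proof. by apply: esum_ge0 => e _; rewrite lee_fin sqr_ge0. Qed.

Lemma hs_norm_ge0 T : 0 <= hs_norm B T.
Proof. exact: sqrtr_ge0. Qed.

Lemma sqr_hs_norm T : hs_finite T -> (hs_norm B T ^+ 2)%:E = hs_norm2 B T.
Proof.
move=> Tf; rewrite /hs_norm sqr_sqrtr ?fine_ge0 ?hs_norm2_ge0// fineK//.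
by rewrite ge0_fin_numE// hs_norm2_ge0.
Qed.

Lemma sum_le_hs_norm2 r T : finite_part r ->
  ((\sum_(e <- r) `|T e| ^+ 2)%:E <= hs_norm2 B T)%E.
Proof.
move=> [ur rB]; apply: ereal_sup_ubound; exists [set` r]; first by split; [exact: finite_seq|exact: rB].
by rewrite -fsbig_seq// sumEFin.
Qed.

Lemma hs_seminorm_le_norm r T : finite_part r -> hs_finite T ->
  hs_seminorm r T <= hs_norm B T.
Proof.
move=> fr Tf; rewrite -ler_sqr ?nnegrE ?sqrtr_ge0// sqr_hs_seminorm.
by rewrite -lee_fin sqr_hs_norm// sum_le_hs_norm2.
Qed.

(** The two conclusions go together because [hs_norm] is 0 when the sum of squares is infinite: a
    bound on it alone would carry no information. *)
Lemma hs_norm_le T (c : R) : 0 <= c ->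
    (forall r, finite_part r -> hs_seminorm r T <= c) ->
  hs_finite T /\ hs_norm B T <= c.
Proof.
move=> c0 Tc; have Tc2 : (hs_norm2 B T <= (c ^+ 2)%:E)%E.
  apply: ge_ereal_sup => _ [A [finA AB] <-].
  rewrite fsbig_finite//= sumEFin lee_fin -sqr_hs_seminorm.
  rewrite ler_sqr ?nnegrE ?sqrtr_ge0//; apply: Tc; split; first exact: finmap.fset_uniq.
  by move=> e; rewrite in_fset_set// => /set_mem /AB.
have Tf : hs_finite T by apply: le_lt_trans Tc2 (ltry _).
by split=> //; rewrite -ler_sqr ?nnegrE ?sqrtr_ge0// -lee_fin sqr_hs_norm.
Qed.

Lemma hs_norm_lim T : hs_finite T ->
  forall eps : R, 0 < eps -> exists2 r, finite_part r &
    hs_norm B T - eps <= hs_seminorm r T.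
Proof.
move=> Tf eps e0; apply: contrapT => nr.
have [c0|c0] := leP 0 (hs_norm B T - eps); last first.
  apply: nr; exists [::]; first by split.
  by rewrite (le_trans (ltW c0))// sqrtr_ge0.
suff [_] : hs_finite T /\ hs_norm B T <= hs_norm B T - eps by lra.
apply: hs_norm_le => // r fr; rewrite leNgt; apply/negP => lt_r.
by apply: nr; exists r => //; exact: ltW.
Qed.

Lemma hs_finiteD T S : hs_finite T -> hs_finite S ->
  hs_finite (T + S) /\ hs_norm B (T + S) <= hs_norm B T + hs_norm B S.
Proof.
move=> Tf Sf; apply: hs_norm_le => [|r fr]; first by rewrite addr_ge0 ?hs_norm_ge0.
by rewrite (le_trans (ler_seminormD (hr r) _ _))// lerD// hs_seminorm_le_norm.
Qed.

Lemma hs_finiteZ a T : hs_finite T ->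
  hs_finite (a *: T) /\ hs_norm B (a *: T) <= `|a| * hs_norm B T.
Proof.
move=> Tf; apply: hs_norm_le => [|r fr]; first by rewrite mulr_ge0 ?hs_norm_ge0.
rewrite /hs_seminorm (seminormZ (hr r)) ler_wpM2l//.
exact: hs_seminorm_le_norm.
Qed.

Lemma hs_finite0 : hs_finite 0 /\ hs_norm B 0 <= 0.
Proof. by apply: hs_norm_le => // r _; rewrite /hs_seminorm (seminorm0 (hr r)). Qed.

Lemma hs_finiteN T : hs_finite T -> hs_finite (- T).
Proof. by move=> /(hs_finiteZ (-1))[]; rewrite scaleN1r. Qed.

Lemma hs_normN T : hs_norm B (- T) = hs_norm B T.
Proof.
by congr (Num.sqrt (fine _)); apply: eq_esum => e _; rewrite normrN.
Qed.

Lemma hs_finiteB T S : hs_finite T -> hs_finite S ->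
  hs_finite (T - S) /\ hs_norm B (T - S) <= hs_norm B T + hs_norm B S.
Proof. by move=> Tf Sf; rewrite -(hs_normN S); apply: hs_finiteD => //; exact: hs_finiteN. Qed.

Lemma hs_finite_sum (I : Type) (s : seq I) (P : pred I) (F : I -> H -> H) :
    (forall i, hs_finite (F i)) ->
  hs_finite (\sum_(i <- s | P i) F i) /\
  hs_norm B (\sum_(i <- s | P i) F i) <= \sum_(i <- s | P i) hs_norm B (F i).
Proof.
move=> Ff; elim/big_ind2 : _ => [|T x S y [Tf Tx] [Sf Sy]|i _]//.
  exact: hs_finite0.
have [TSf TSn] := hs_finiteD Tf Sf; split => //.
by rewrite (le_trans TSn)// lerD.
Qed.

Lemma hs_norm_distD T S U : hs_finite (T - S) -> hs_finite (S - U) ->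
  hs_norm B (T - U) <= hs_norm B (T - S) + hs_norm B (S - U).
Proof. by move=> /hs_finiteD/[apply] -[_]; rewrite subrKA. Qed.

(** [g] is the orthogonal projection of [f] on the span of [r]; both [dot f g] and [dot g g] equal
    the sum, and the inequality is |f - g|^2 >= 0. *)
Lemma bessel r f : finite_part r -> \sum_(e <- r) dot f e ^+ 2 <= `|f| ^+ 2.
Proof.
move=> [ur rB]; pose g := \sum_(e <- r) dot f e *: e.
have gE e : e \in r -> dot g e = dot f e.
  move=> er; rewrite /g (ipC hd) (ip_sumr hd) (bigD1_seq e)//= big1_seq ?addr0.
    by rewrite (ipZr hd) hB.1; [rewrite eqxx mulr1|exact: rB|exact: rB].
  move=> e' /andP[ne e'r]; rewrite (ipZr hd) hB.1; [|exact: rB|exact: rB].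
  by rewrite eq_sym (negbTE ne) mulr0.
have fg : dot f g = \sum_(e <- r) dot f e ^+ 2.
  by rewrite /g (ip_sumr hd); apply: eq_bigr => e _; rewrite (ipZr hd) expr2.
have gg : dot g g = \sum_(e <- r) dot f e ^+ 2.
  rewrite {2}/g (ip_sumr hd); apply: eq_big_seq => e er.
  by rewrite (ipZr hd) gE// expr2.
have := sqr_ge0 `|f - g|; rewrite -hdot -scaleN1r addrC (ipPl hd).
by rewrite !(ipDr hd) !(ipZr hd) -hdot (ipC hd g f) fg gg; lra.
Qed.

Lemma hs_tensor f g : hs_finite (tensor dot f g) /\
  hs_norm B (tensor dot f g) <= `|f| * `|g|.
Proof.
apply: hs_norm_le => [|r fr]; first by rewrite mulr_ge0.
rewrite -ler_sqr ?nnegrE ?sqrtr_ge0 ?mulr_ge0// sqr_hs_seminorm exprMn.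
rewrite (eq_bigr (fun e => dot f e ^+ 2 * `|g| ^+ 2)); last first.
  by move=> e _; rewrite /tensor normrZ exprMn -normrX ger0_norm ?sqr_ge0.
by rewrite -mulr_suml ler_wpM2r ?sqr_ge0// bessel.
Qed.

Lemma hs_finite_tensor f g : hs_finite (tensor dot f g).
Proof. by case: (hs_tensor f g). Qed.

Lemma hs_norm_tensor f g : hs_norm B (tensor dot f g) <= `|f| * `|g|.
Proof. by case: (hs_tensor f g). Qed.

Lemma tensor_diff f g : tensor dot f f - tensor dot g g =
  tensor dot f (f - g) + tensor dot (f - g) g.
Proof.
apply/funext => h; rewrite /tensor !fctE /= linearBl scalerBr scalerBl.
by rewrite addrA subrK.
Qed.

(** The tensor square is 2-Lipschitz on the unit ball, which carries convergence of vectors of [H]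
    over to their tensors. *)
Lemma hs_norm_tensor_diff f g : `|f| <= 1 -> `|g| <= 1 ->
  hs_norm B (tensor dot f f - tensor dot g g) <= 2 * `|f - g|.
Proof.
move=> f1 g1; rewrite tensor_diff.
have [_ h] := hs_finiteD (hs_finite_tensor f (f - g)) (hs_finite_tensor (f - g) g).
apply: le_trans h _; apply: le_trans (lerD (hs_norm_tensor _ _) (hs_norm_tensor _ _)) _.
have n0 := normr_ge0 (f - g).
by have := ler_wpM2r n0 f1; have := ler_wpM2l n0 g1; lra.
Qed.

Lemma linear_continuous_bounded T (c : R) : linear T ->
  (forall h, `|T h| <= c * `|h|) -> continuous T.
Proof.
move=> Tl Tc; pose lT := GRing.isLinear.Build _ _ _ _ T Tl.
pose L : {linear H -> H} := HB.pack T lT.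
apply: (@bounded_linear_continuous _ _ _ L) => /=.
apply/(linear_boundedP L); near=> M => x.
by rewrite /= (le_trans (Tc x))// ler_wpM2r.
Unshelve. all: by end_near. Qed.

Lemma HS_op_tensor f g : HS_op B (tensor dot f g).
Proof.
have tl : linear (tensor dot f g).
  move=> a x y; rewrite /tensor linearPr/=.
  by rewrite scalerDl scalerA.
split=> //; last exact: hs_finite_tensor.
apply: (@linear_continuous_bounded _ (`|f| * `|g|)) => // h.
rewrite /tensor normrZ mulrAC ler_wpM2r//; exact: dot_cauchy_schwarz.
Qed.

End HilbertSchmidtNorm.

(** * Finitely-valued random variables *)

Section Labelings.
Context {d : measure_display} {T : measurableType d} {R : realType}.
Variable P : probability T R.
Implicit Types (D : set T).

(** A finitely-valued random variable. Measurability is asked fibre by fibre, so no sigma-algebra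
    has to be put on [F]. *)
Definition labeling (F : finType) (L : T -> F) :=
  forall b, measurable (L @^-1` [set b]).

Lemma labeling_preimage (F : finType) (L : T -> F) (Q : set F) :
  labeling L -> measurable (L @^-1` Q).
Proof.
move=> mL; rewrite [X in measurable X](_ : _ = \bigcup_(b in Q) (L @^-1` [set b])).
  by apply: fin_bigcup_measurable => [|b _]; [exact: finite_finset|exact: mL].
by apply/seteqP; split => [w Qw|w [b Qb Lb]]; [exists (L w)|rewrite /= Lb].
Qed.

Lemma labeling_measurable_fun {d'} {T' : measurableType d'} (F : finType)
  (L : T -> F) (D : set T) (g : F -> T') :
  measurable D -> labeling L -> measurable_fun D (fun w => g (L w)).
Proof.
move=> mD mL _ Y mY; apply: measurableI => //.
exact: (@labeling_preimage _ _ (g @^-1` Y)).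
Qed.

Lemma labeling_pair (F G : finType) (L : T -> F) (L' : T -> G) :
  labeling L -> labeling L' -> labeling (fun w => (L w, L' w)).
Proof.
move=> mL mL' [b b']; rewrite [X in measurable X](_ : _ =
    L @^-1` [set b] `&` L' @^-1` [set b']); first exact: measurableI.
by apply/seteqP; split => w /= [<- <-].
Qed.

Lemma labeling_ffun (I F : finType) (L : I -> T -> F) :
  (forall i, labeling (L i)) -> labeling (fun w => [ffun i => L i w]).
Proof.
move=> mL f; rewrite [X in measurable X](_ : _ =
    \bigcap_(i in [set: I]) (L i @^-1` [set f i])).
  by apply: fin_bigcap_measurable => [|i _]; [exact: finite_finset|exact: mL].
apply/seteqP; split => [w /= <- i _|w /= Lw]; first by rewrite ffunE.
by apply/ffunP => i; rewrite ffunE; exact: Lw.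
Qed.

Lemma labeling_integral (F : finType) (L : T -> F) D (g : F -> R) :
    measurable D -> labeling L -> (forall b, 0 <= g b) ->
  (\int[P]_(w in D) (g (L w))%:E)%E =
  (\sum_b fine (P (D `&` L @^-1` [set b])) * g b)%:E.
Proof.
move=> mD mL g0.
transitivity (\int[P]_(w in D)
    \sum_b ((g b)%:E * (\1_(L @^-1` [set b]) w)%:E))%E.
  apply: eq_integral => w _; rewrite (bigD1 (L w))//= big1 ?adde0.
    by rewrite indicE mem_set// mule1.
  by move=> b nb; rewrite indicE memNset ?mule0// => /= /esym/eqP; apply/negP.
have mi b : measurable_fun D (fun w => (\1_(L @^-1` [set b]) w : R)).
  exact: measurable_indic (mL b).
rewrite ge0_integral_sum//; last 2 first.
- by move=> b; apply/measurable_EFinP; apply: measurable_funM.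
- by move=> b w _; rewrite -EFinM lee_fin mulr_ge0.
rewrite -sumEFin; apply: eq_bigr => b _.
rewrite ge0_integralZl_EFin//; last by apply/measurable_EFinP.
rewrite (integral_indic _ mD (mL b)) EFinM muleC fineK 1?setIC//.
by apply: fin_num_measure; apply: measurableI => //; exact: mL.
Qed.

Lemma probability_labeling (F : finType) (L : T -> F) D (Q : pred F) :
    measurable D -> labeling L ->
  fine (P (D `&` L @^-1` [set b | Q b])) =
  \sum_(b | Q b) fine (P (D `&` L @^-1` [set b])).
Proof.
move=> mD mL; have mQ : measurable (L @^-1` [set b | Q b]) by exact: labeling_preimage.
have := labeling_integral mD mL (fun b => ler0n R (Q b)).
rewrite [LHS](_ : _ = \int[P]_(w in D) (\1_(L @^-1` [set b | Q b]) w)%:E)%E.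
  rewrite integral_indic// setIC => ->/=.
  by rewrite [RHS]big_mkcond/=; apply: eq_bigr => b _; case: (Q b); rewrite ?mulr1 ?mulr0.
by apply: eq_integral => w _; rewrite indicE; congr ((nat_of_bool _)%:R%:E); apply/idP/idP;
  rewrite in_setE.
Qed.

(** Several labels may share a value of [g]; the weight of that value is the sum of the weights of
    its labels. Since any labeling may be used, two simple functions can be compared through a joint
    one. *)
Lemma simple_integral_labeling (E : lmodType R) (F : finType) (L : T -> F) D
    (g : F -> E) : measurable D -> labeling L ->
  simple_integral P D (g \o L) =
  \sum_b fine (P (D `&` L @^-1` [set b])) *: g b.
Proof.
move=> mD mL; rewrite /simple_integral.
set s := undup [seq g b | b <- enum F].
rewrite (@fsbig_widen _ _ _ _ _ [set` s]).
- rewrite -fsbig_seq ?undup_uniq//.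
  transitivity (\sum_(v <- s) \sum_b
      (if g b == v then fine (P (D `&` L @^-1` [set b])) *: g b else 0)).
    apply: eq_bigr => v _; rewrite -big_mkcond/=.
    rewrite (_ : (g \o L) @^-1` [set v] = L @^-1` [set b | g b == v]); last first.
      by apply/seteqP; split => w /=; [move=> <-|move=> /eqP].
    rewrite (@probability_labeling _ _ _ (fun b => g b == v))// scaler_suml.
    by apply: eq_bigr => b /eqP ->.
  rewrite exchange_big/=; apply: eq_bigr => b _.
  rewrite (bigD1_seq (g b)) ?undup_uniq//=.
    by rewrite eqxx big1 ?addr0// => v; rewrite eq_sym => /negbTE ->.
  by rewrite mem_undup map_f// mem_enum.
- by move=> _ [w _ <-] /=; rewrite mem_undup map_f// mem_enum.
- move=> v [_ /= vnr].
  rewrite (_ : (g \o L) @^-1` [set v] = set0) ?setI0 ?measure0 ?scale0r//.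
  by apply/seteqP; split => // w /= gw; apply: vnr; exists w.
Qed.

(* The junk value [0] is used on labels that are never attained. *)
Lemma bochner_simple_labeling (E : lmodType R) (V : set E) (s : T -> E) :
    bochner_simple V s -> V 0 ->
  exists (m : nat) (L : T -> 'I_m) (g : 'I_m -> E),
    [/\ labeling L, forall b, V (g b) & s = g \o L].
Proof.
move=> [/finite_seqP[l rl] ms Vs] V0.
have sl w : s w \in l by have : range s (s w); [exists w|rewrite rl].
have Lw w : (index (s w) l < size l)%N by rewrite index_mem.
exists (size l), (fun w => Ordinal (Lw w)), (fun i => nth 0 l i); split.
- move=> b; rewrite [X in measurable X](_ : _ =
      if index (nth 0 l b) l == b then s @^-1` [set nth 0 l b] else set0); last first.
    apply/seteqP; split => w /=.
      move=> /(congr1 val)/= wb; have swb : s w = nth 0 l b by rewrite -wb nth_index.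
      by rewrite -swb wb eqxx.
    case: ifPn => // /eqP ib /= swb; apply/val_inj => /=.
    by rewrite swb.
  by case: ifP.
- move=> b; have : range s (nth 0 l b) by rewrite rl /= mem_nth.
  by case=> w _ <-.
- by apply/funext => w /=; rewrite nth_index.
Qed.

End Labelings.

Section IndependentLabels.
Context {d : measure_display} {T : measurableType d} {R : realType}.
Context {H : completeNormedModType R}.
Variables (P : probability T R) (X : T -> H) (n : nat) (X_ : 'I_n -> T -> H).
Hypothesis hcopies : independent_copies P X X_.
Variables (F : finType) (lab : H -> F).
Hypothesis mlab : forall b, measurable (lab @^-1` [set b] : set (borel_space H)).

Lemma random_element_labeling (Y : T -> H) :
  random_element Y -> labeling (fun w => lab (Y w)).
Proof.
move=> mY b; have := mY measurableT _ (mlab b); rewrite setTI.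
exact.
Qed.

(** Independence factors the probability of each vector of labels, and the common law replaces every
    [X_ i] by [X]. This is the bridge from the sample to the finite sums of [pinelis]. *)
Lemma integral_independent_labels (g : {ffun 'I_n -> F} -> R) :
    (forall f, 0 <= g f) ->
  (\int[P]_w (g [ffun i => lab (X_ i w)])%:E)%E =
  (\sum_(f : {ffun 'I_n -> F})
     (\prod_i fine (P (X @^-1` (lab @^-1` [set f i])))) * g f)%:E.
Proof.
case: hcopies => mX lawX indep g0.
have mL : labeling (fun w => [ffun i => lab (X_ i w)]).
  by apply: labeling_ffun => i; exact: random_element_labeling.
rewrite (labeling_integral P measurableT mL g0); congr (_%:E).
apply: eq_bigr => f _; congr (_ * _); rewrite setTI.
have := indep [set: 'I_n]%SET (fun i => lab @^-1` [set f i]) (fun i => mlab (f i)).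
have -> : \bigcap_(i in [set` [set: 'I_n]%SET]) (X_ i @^-1` (lab @^-1` [set f i])) =
    (fun w => [ffun i => lab (X_ i w)]) @^-1` [set f].
  apply/seteqP; split => [w /= Xw|w /= <- i _]; last by rewrite /= ffunE.
  by apply/ffunP => i; rewrite ffunE; apply: Xw; rewrite /= inE.
move=> ->; rewrite [X in fine X](_ : _ = \prod_i (fine (P (X @^-1` (lab @^-1` [set f i]))))%:E)%E.
  by rewrite prodEFin.
apply: eq_big => [i|i _]; first by rewrite inE.
have fi : P (X_ i @^-1` (lab @^-1` [set f i])) \is a fin_num.
  by apply: fin_num_measure; exact: random_element_labeling.
by rewrite -(lawX i _ (mlab (f i))) fineK.
Qed.

End IndependentLabels.

(** * Finitely-valued approximation of the angle *)

Section FiniteApproximation.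
Context {R : realType} {H : completeNormedModType R}.
Implicit Types (u v x y : H).

(** The radial retraction onto the closed unit ball, where the exponential bound wants the
    approximating vectors to be. *)
Definition truncate u : H := (Num.max 1 `|u|)^-1 *: u.

Lemma norm_truncate_le1 u : `|truncate u| <= 1.
Proof.
have m0 : 0 < Num.max 1 `|u| by rewrite lt_max ltr01.
rewrite normrZ normfV (gtr0_norm m0) mulrC ler_pdivrMr// mul1r.
by rewrite le_max lexx orbT.
Qed.

(** Outside the ball the retraction moves [u] by |u| - 1 <= |u| - |y| <= |y - u|; hence the factor
    2. *)
Lemma dist_truncate y u : `|y| <= 1 -> `|y - truncate u| <= 2 * `|y - u|.
Proof.
move=> y1; have n0 := normr_ge0 (y - u).
have [u1|u1] := leP `|u| 1; first by rewrite /truncate max_l// invr1 scale1r; lra.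
rewrite /truncate max_r; last exact: ltW.
rewrite -[y - _](subrKA u) (le_trans (ler_normD _ _))//.
have -> : `|u - `|u|^-1 *: u| = `|u| - 1.
  rewrite -{1}[u]scale1r -scalerBl normrZ ger0_norm; last first.
    by rewrite subr_ge0 invf_le1 ?ltW// (lt_trans ltr01).
  by rewrite mulrBl mul1r mulVf// gt_eqF// (lt_trans ltr01).
have := lerB_dist u y; rewrite distrC; lra.
Qed.

Lemma separable_dense_seq : separable_space H ->
  exists u : nat -> H, forall x (eps : R), 0 < eps -> exists i, `|x - u i| < eps.
Proof.
move=> [S [/countable_injP[g ginj] dS]].
(* The sequence inverts the injection [g] of [S] into the natural numbers, with the harmless value 0
   at indices that are not attained. *)
exists (fun i => xget 0 [set x | S x /\ g x = i]) => x eps e0.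
have [|y [xy Sy]] := dS (ball x eps) _ (@ball_open _ _ x eps).
  by exists x; exact: ballxx.
exists (g y); suff -> : xget 0 [set z | S z /\ g z = g y] = y.
  by move: xy; rewrite -ball_normE.
case: xgetP => [z _ [Sz gz]|/(_ y)/not_andP[]//].
by apply: ginj => //; exact: mem_set.
Qed.

Lemma labeling_bool (A : set (borel_space H)) :
  measurable A -> labeling (fun x : borel_space H => `[< A x >]).
Proof.
move=> mA [].
  rewrite [X in measurable X](_ : _ = A)//.
  by apply/seteqP; split => x /=; [move=> /asboolP|move=> Ax; apply/asboolP].
rewrite [X in measurable X](_ : _ = ~` A); first exact: measurableC.
by apply/seteqP; split => x /=; [move=> /asboolP|move=> Ax; apply/asboolP].
Qed.

(* At stage [m] a point [x] of [D] is sent to (the truncation of) a point nearest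
   to [f x] among the first [m] points of a dense sequence. *)
Lemma finite_approximation (f : H -> H) (D : set H) : separable_space H ->
    (forall x, `|f x| <= 1) ->
    (forall u v, measurable
      ([set x | D x /\ `|f x - u| <= `|f x - v|] : set (borel_space H))) ->
  exists (F : nat -> finType) (lab : forall m, H -> F m) (dec : forall m, F m -> H),
    [/\ forall m b, measurable (lab m @^-1` [set b] : set (borel_space H)),
        forall m b, `|dec m b| <= 1,
        forall x, D x -> (fun m => dec m (lab m x)) @ \oo --> f x &
        forall m x, ~ D x -> dec m (lab m x) = 0].
Proof.
move=> /separable_dense_seq[u du] f1 mD.
pose C (i j : nat) := [set x | D x /\ `|f x - u i| <= `|f x - u j|].
exists (fun m => {ffun 'I_m * 'I_m -> bool}).
(* A label is the table of all comparisons between the first [m] points, from which a winning index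
   is read off. Outside [D] every entry is false, so no index is found and the value is 0. *)
exists (fun m x => [ffun ij : 'I_m * 'I_m => `[< C ij.1 ij.2 x >]]).
exists (fun m (b : {ffun 'I_m * 'I_m -> bool}) =>
  if [pick i : 'I_m | [forall j, b (i, j)]] is Some i
                  then truncate (u i) else 0).
split.
- move=> m; apply: (@labeling_ffun _ (borel_space H) _ _
    (fun (ij : 'I_m * 'I_m) (x : borel_space H) => `[< C ij.1 ij.2 x >])).
  by move=> [i j]; apply: labeling_bool; exact: mD.
- move=> m b; case: pickP => [i _|_]; first exact: norm_truncate_le1.
  by rewrite normr0.
- move=> x Dx; apply/cvgrPdist_le => eps e0.
  (* Half of [eps], since truncation may double the distance. *)
  have [i0 xi0] := du (f x) _ (divr_gt0 e0 (ltr0Sn R 1)).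
  exists i0.+1 => // m /= i0m; case: pickP => [i /forallP Ci|nC]; last first.
    pose i1 := Ordinal i0m.
    case: (@arg_minP _ _ _ i1 xpredT (fun i : 'I_m => `|f x - u i|) isT) => i _ imin.
    have /forallP[] := negbT (nC i) => j.
    by rewrite ffunE; apply/asboolP; split=> //; exact: imin.
  rewrite (le_trans (dist_truncate _ (f1 x)))//.
  have := Ci (Ordinal i0m); rewrite ffunE => /asboolP[_ /=]; lra.
- move=> m x nDx; case: pickP => // i /forallP/(_ i).
  by rewrite ffunE => /asboolP[].
Qed.

Lemma continuous_borel_measurable (phi : H -> R) : continuous phi ->
  measurable_fun [set: borel_space H] (phi : borel_space H -> R).
Proof.
move=> cphi; apply: (measurability _ (RGenOInfty.measurableE R)) => _ [_ [a ->] <-].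
rewrite setTI; apply: sub_sigma_algebra.
by apply: open_comp => //; exact: open_gt.
Qed.

End FiniteApproximation.

Section AngleApproximation.
Context {R : realType} {H : completeNormedModType R}.
Variables (dot : {dot H for idfun}).
Hypothesis hdot : is_inner_product dot.

Lemma norm_angle x : x != 0 :> H -> `|angle x| = 1.
Proof. by move=> x0; rewrite /angle normrZ normfV normr_id mulVf// normr_eq0. Qed.

Lemma angle0 : angle (0 : H) = 0.
Proof. by rewrite /angle scaler0. Qed.

Lemma norm_angle_le1 (x : H) : `|angle x| <= 1.
Proof. by have [->|/norm_angle->//] := eqVneq x 0; rewrite angle0 normr0. Qed.

Lemma measurable_exceedance (t : \bar R) :
  measurable ([set x : H | (t < `|x|%:E)%E] : set (borel_space H)).
Proof.
have mn := continuous_borel_measurable (@norm_continuous _ H).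
have me : measurable_fun [set: borel_space H] (fun x : H => `|x|%:E).
  exact/measurable_EFinP.
have mt : measurable_fun [set: borel_space H] (fun _ : H => t) by [].
by have := measurable_lte measurableT mt me; rewrite setTI.
Qed.

(** After squaring and cancelling the square of the angle, multiplication by |x| turns the
    comparison into [h x <= c * |x|], an inequality between continuous functions of x. The point 0
    is excluded so that this multiplication is reversible. *)
Lemma measurable_angle_closer (t : \bar R) (u v : H) :
  measurable ([set x : H | ((t < `|x|%:E)%E /\ x != 0) /\
    `|angle x - u| <= `|angle x - v|] : set (borel_space H)).
Proof.
have mn := continuous_borel_measurable (@norm_continuous _ H).
have mh := continuous_borel_measurable (dot_continuous hdot (f := 2 *: (v - u))).
set h := dot (2 *: (v - u)) : H -> R in mh.
have m0 : measurable_fun [set: borel_space H] (fun _ : H => (0 : R)) by [].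
pose c := `|v| ^+ 2 - `|u| ^+ 2.
have mc : measurable_fun [set: borel_space H] (fun x : H => c * `|x|).
  exact: measurable_funM.
have m1 := measurable_fun_le measurableT mh mc; rewrite setTI in m1.
have m2 := measurable_fun_le measurableT mn m0; rewrite setTI in m2.
rewrite [X in measurable X](_ : _ = [set x : borel_space H | (t < `|x : H|%:E)%E] `&`
    ([set x | h x <= c * `|x : H|] `\` [set x : borel_space H | `|x : H| <= 0])).
  by apply: measurableI; [exact: measurable_exceedance|exact: measurableD].
have key (x : H) : x != 0 -> (`|angle x - u| <= `|angle x - v|) = (h x <= c * `|x|).
  move=> x0; have xp : 0 < `|x| by rewrite normr_gt0.
  have hd := dot_semi_inner_product hdot.
  rewrite -ler_sqr ?nnegrE// -!hdot -[- u]scaleN1r -[- v]scaleN1r.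
  rewrite -[RHS]ler_pdivrMr// /h /c -[v - u]addrC -[- u]scaleN1r.
  rewrite !(ipDl hd) !(ipDr hd) !(ipZl hd) !(ipZr hd) !(ipDl hd) !(ipZl hd) !hdot.
  rewrite (ipC hd u) (ipC hd v).
  rewrite -subr_ge0 -[RHS]subr_ge0; congr (0 <= _).
  by field; rewrite gt_eqF.
apply/seteqP; split => x /=.
  by move=> [[tx x0]]; rewrite key// normr_le0 => hx; do 2!split => //; exact/negP.
by move=> [tx [hx /negP]]; rewrite normr_le0 => x0; split=> //; rewrite key.
Qed.

End AngleApproximation.

(** * Bochner integrals of rank-one tensors *)

Lemma cvg_sum_seq {R : realType} (I : Type) (r : seq I) (F : I -> nat -> R) (a : I -> R) :
    (forall i, F i @ \oo --> a i) ->
  (fun l => \sum_(i <- r) F i l) @ \oo --> \sum_(i <- r) a i.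
Proof.
move=> Fa; elim: r => [|i r IH].
  by rewrite big_nil (_ : (fun _ => _) = cst 0); [exact: cvg_cst|apply/funext => l; rewrite big_nil].
rewrite big_cons (_ : (fun _ => _) = (fun l => F i l + \sum_(j <- r) F j l)).
  by apply: cvgD; [exact: Fa|exact: IH].
by apply/funext => l; rewrite big_cons.
Qed.

Section BoundedConvergence.
Context {d : measure_display} {T : measurableType d} {R : realType}.
Variable P : probability T R.

Lemma bounded_convergence (D : set T) (g_ : nat -> T -> R) (g : T -> R) (c : R) :
    measurable D -> (forall m, measurable_fun D (g_ m)) ->
    (forall w, D w -> g_ ^~ w @ \oo --> g w) ->
    (forall m w, D w -> `|g_ m w| <= c) ->
  measurable_fun D g /\
  (fun m => \int[P]_(w in D) (g_ m w)%:E)%E @ \oo --> (\int[P]_(w in D) (g w)%:E)%E.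
Proof.
move=> mD mg_ gc gb; have mg : measurable_fun D g by exact: measurable_fun_cvg gc.
split=> //.
have ic : P.-integrable D (EFin \o cst c) by exact: finite_measure_integrable_cst.
have := @dominated_convergence _ _ _ P D mD (fun m w => (g_ m w)%:E) (EFin \o g)
  (EFin \o cst c) _ _ _ ic _; case.
- by move=> m; apply/measurable_EFinP; exact: mg_.
- exact/measurable_EFinP.
- by apply: aeW => w /= Dw; apply: cvg_EFin; [exact: nearW|exact: gc].
- by apply: aeW => w m Dw; rewrite /= lee_fin; exact: gb.
- by [].
Qed.

Lemma integral_le_bound (D : set T) (g : T -> R) (c : R) : measurable D ->
    measurable_fun D g -> (forall w, D w -> 0 <= g w <= c) -> 0 <= c ->
  (0 <= \int[P]_(w in D) (g w)%:E <= c%:E)%E.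
Proof.
move=> mD mg gb c0; apply/andP; split.
  by apply: integral_ge0 => w /gb/andP[]; rewrite lee_fin.
apply: (@le_trans _ _ (\int[P]_(w in D) (cst c%:E) w)%E).
  apply: ge0_le_integral => //.
  - by move=> w /gb/andP[]; rewrite lee_fin.
  - exact/measurable_EFinP.
  - by move=> w /gb/andP[]; rewrite lee_fin.
rewrite integral_cst//= -[leRHS]mule1 lee_pmul//.
exact: probability_le1.
Qed.

End BoundedConvergence.

Section TensorApproximation.
Context {R : realType} {H : completeNormedModType R}.
Variables (dot : {dot H for idfun}) (B : set H).
Hypothesis hdot : is_inner_product dot.
Hypothesis hB : orthonormal_basis dot B.
Context {d : measure_display} {T : measurableType d}.
Variable P : probability T R.
Variables (D : set T) (theta : T -> H).
Variables (F : nat -> finType) (L : forall m, T -> F m) (dec : forall m, F m -> H).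
Arguments dec : clear implicits.
Hypothesis mD : measurable D.
Hypothesis mL : forall m, labeling (L m).
Hypothesis dec1 : forall m b, `|dec m b| <= 1.
Hypothesis theta1 : forall w, `|theta w| <= 1.
Hypothesis dec_cvg : forall w, (fun m => dec m (L m w)) @ \oo --> theta w.

Arguments mL : clear implicits.
Arguments dec1 : clear implicits.

Local Notation q m w := (dec m (L m w)).
Local Notation square h := (tensor dot h h).
Local Notation nrm := (hs_norm B).

Definition label_mean m : H -> H :=
  \sum_b fine (P (D `&` L m @^-1` [set b])) *: square (dec m b).
Local Notation J := label_mean.

(** Pairing the two labels puts both sums over one index set, where they are subtracted term by
    term. *)
Lemma label_mean_sub m l : J m - J l =
  \sum_b fine (P (D `&` (fun w => (L m w, L l w)) @^-1` [set b])) *: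
    (square (dec m b.1) - square (dec l b.2)).
Proof.
have mLL := labeling_pair (mL m) (mL l).
rewrite /label_mean.
rewrite -(simple_integral_labeling P (fun b => square (dec m b)) mD (mL m)).
rewrite -(simple_integral_labeling P (fun b => square (dec l b)) mD (mL l)).
rewrite (_ : (fun b => square (dec m b)) \o L m =
  (fun b : F m * F l => square (dec m b.1)) \o (fun w => (L m w, L l w)))//.
rewrite (_ : (fun b => square (dec l b)) \o L l =
  (fun b : F m * F l => square (dec l b.2)) \o (fun w => (L m w, L l w)))//.
rewrite !simple_integral_labeling// -sumrB; apply: eq_bigr => b _.
by rewrite scalerBr.
Qed.

Lemma dist_theta_cvg m w : (fun l => `|q l w - q m w|) @ \oo --> `|theta w - q m w|.
Proof.
by apply: cvg_norm; apply: cvgB; [exact: dec_cvg|exact: cvg_cst].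
Qed.

Lemma measurable_dist_theta m : measurable_fun D (fun w => `|theta w - q m w|).
Proof.
apply: (@measurable_fun_cvg _ _ _ _ (fun l w => `|q l w - q m w|)).
  move=> l; exact: (labeling_measurable_fun (fun b : F l * F m =>
    `|dec l b.1 - dec m b.2|) mD (labeling_pair (mL l) (mL m))).
by move=> w _; exact: dist_theta_cvg.
Qed.

Lemma dist_theta_le2 m w : `|theta w - q m w| <= 2.
Proof. by rewrite (le_trans (ler_normB _ _))// (le_trans (lerD (theta1 _) (dec1 _ _))). Qed.

Definition approx_error m : R := fine (\int[P]_(w in D) (`|theta w - q m w|)%:E).
Local Notation err := approx_error.

Lemma approx_errorE m : (\int[P]_(w in D) (`|theta w - q m w|)%:E)%E = (err m)%:E.
Proof.
have h : (0 <= \int[P]_(w in D) (`|theta w - q m w|)%:E <= 2%:E)%E.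
  apply: integral_le_bound => //; first exact: measurable_dist_theta.
  by move=> w _; rewrite normr_ge0 dist_theta_le2.
have /andP[h0 h2] := h; rewrite /approx_error fineK// ge0_fin_numE//.
exact: le_lt_trans h2 (ltry _).
Qed.

Lemma approx_error_cvg0 : err @ \oo --> 0.
Proof.
have c0 w : D w -> (fun m => `|theta w - q m w|) @ \oo --> (0 : R).
  move=> _; rewrite -(@normr0 _ H) -(subrr (theta w)).
  by apply: cvg_norm; apply: cvgB; [exact: cvg_cst|exact: dec_cvg].
have b2 m w : D w -> `| `|theta w - q m w| | <= 2.
  by move=> _; rewrite normr_id dist_theta_le2.
have [_] := bounded_convergence P mD measurable_dist_theta c0 b2.
by rewrite integral0 => h; exact: (fine_cvg h).
Qed.

(** The sum is the integral over [D] of the distance between two approximations, and the triangle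
    inequality passes through [theta]. All Cauchy estimates below rest on this. *)
Lemma label_dist_le m l :
  \sum_b fine (P (D `&` (fun w => (L m w, L l w)) @^-1` [set b])) *
    `|dec m b.1 - dec l b.2| <= err m + err l.
Proof.
have mLL := labeling_pair (mL m) (mL l).
rewrite -lee_fin EFinD -!approx_errorE.
rewrite -(labeling_integral P mD mLL (fun b : F m * F l =>
  normr_ge0 (dec m b.1 - dec l b.2))).
have mq k : measurable_fun D (fun w => (`|theta w - q k w|)%:E).
  by apply/measurable_EFinP; exact: measurable_dist_theta.
rewrite -ge0_integralD//.
apply: ge0_le_integral => //.
- apply/measurable_EFinP; exact: (labeling_measurable_fun (fun b : F m * F l =>
    `|dec m b.1 - dec l b.2|) mD mLL).
- exact: emeasurable_funD.
- move=> w _ /=; rewrite lee_fin (distrC (theta w) (q m w)) -[_ - _](subrKA (theta w)).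
  exact: ler_normD.
Qed.

Lemma weight_ge0 m b : 0 <= fine (P (D `&` L m @^-1` [set b])).
Proof. by apply: fine_ge0. Qed.

Lemma sum_weight_le1 m : \sum_b fine (P (D `&` L m @^-1` [set b])) <= 1.
Proof.
have := labeling_integral P mD (mL m) (fun=> ler01).
rewrite integral_cst// mul1e => PD.
under eq_bigr do rewrite -[fine _]mulr1.
by rewrite -lee_fin -PD; exact: probability_le1.
Qed.

Lemma hs_label_mean m : HS_op B (J m).
Proof.
rewrite /label_mean; elim/big_ind : _ => [|S U [Sl Sc Sf] [Ul Uc Uf]|b _].
- by split=> [a x y|x|]; [rewrite scaler0 addr0|exact: cvg_cst|case: (hs_finite0 B hdot)].
- split=> [a x y|x|].
  + by rewrite !fctE Sl Ul scalerDr addrACA.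
  + by apply: cvgD; [exact: Sc|exact: Uc].
  + by have [] := hs_finiteD hdot Sf Uf.
- have [tl tc tf] := HS_op_tensor hdot hB (dec m b) (dec m b).
  split=> [a x y|x|].
  + by rewrite !fctE tl scalerDr [X in X + _]scalerA mulrC -scalerA.
  + by apply: cvgZr; exact: tc.
  + by have [] := hs_finiteZ hdot (fine (P (D `&` L m @^-1` [set b]))) tf.
Qed.

Lemma fsum_apply (I : finType) (G : I -> H -> H) h : (\sum_i G i) h = \sum_i G i h.
Proof. by rewrite fct_sumE. Qed.

Lemma norm_square_sub (u v h : H) : `|u| <= 1 -> `|v| <= 1 ->
  `|(square u - square v) h| <= 2 * `|u - v| * `|h|.
Proof.
move=> u1 v1; rewrite tensor_diff !fctE /tensor.
apply: le_trans (ler_normD _ _) _; rewrite !normrZ.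
have h1 := ler_wpM2r (normr_ge0 (u - v)) (dot_cauchy_schwarz hdot u h).
have h2 := ler_wpM2r (normr_ge0 v) (dot_cauchy_schwarz hdot (u - v) h).
apply: le_trans (lerD h1 h2) _.
have p0 : 0 <= `|h| * `|u - v| by rewrite mulr_ge0.
have := ler_wpM2r p0 u1; have := ler_wpM2r p0 v1.
by lra.
Qed.

Lemma label_mean_apply_dist m l h :
  `|J m h - J l h| <= 2 * (err m + err l) * `|h|.
Proof.
rewrite -[J m h - J l h]/((J m - J l) h) label_mean_sub fsum_apply.
apply: le_trans (ler_norm_sum _ _ _) _.
apply: le_trans (_ : _ <= (2 * `|h|) * (err m + err l)) _; last first.
  by rewrite mulrAC -mulrA.
apply: le_trans (ler_wpM2l _ (label_dist_le m l)); last by rewrite mulr_ge0.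
rewrite mulr_sumr; apply: ler_sum => b _.
rewrite [X in `|X|]/(fine _ *: (square (dec m b.1) - square (dec l b.2)) h).
rewrite normrZ ger0_norm ?fine_ge0// mulrCA ler_wpM2l ?fine_ge0//.
by rewrite (le_trans (norm_square_sub _ _ _))// mulrAC.
Qed.

Lemma label_mean_hs_dist m l : hs_finite B (J m - J l) /\
  nrm (J m - J l) <= 2 * (err m + err l).
Proof.
rewrite label_mean_sub.
have tf b : hs_finite B (square (dec m b.1) - square (dec l b.2)).
  by have [] := hs_finiteB hdot (hs_finite_tensor hdot hB (dec m b.1) (dec m b.1))
    (hs_finite_tensor hdot hB (dec l b.2) (dec l b.2)).
have cf b : hs_finite B (fine (P (D `&` (fun w => (L m w, L l w)) @^-1` [set b])) *:
    (square (dec m b.1) - square (dec l b.2))).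
  by case: (hs_finiteZ hdot (fine (P (D `&` (fun w => (L m w, L l w)) @^-1` [set b]))) (tf b)).
have [Sf Sn] := hs_finite_sum hdot (index_enum _) xpredT cf.
split=> //; apply: le_trans Sn _.
apply: le_trans (ler_wpM2l _ (label_dist_le m l)) => //.
rewrite mulr_sumr; apply: ler_sum => b _.
have [_] := hs_finiteZ hdot (fine (P (D `&` (fun w => (L m w, L l w)) @^-1` [set b]))) (tf b).
move=> /le_trans; apply; rewrite ger0_norm ?fine_ge0// mulrCA ler_wpM2l ?fine_ge0//.
exact: hs_norm_tensor_diff.
Qed.

Lemma hs_norm_label_mean_le1 m : nrm (J m) <= 1.
Proof.
pose c b := fine (P (D `&` L m @^-1` [set b])).
have tf b : hs_finite B (c b *: square (dec m b)) /\ nrm (c b *: square (dec m b)) <= c b.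
  have [tf tn] := hs_finiteZ hdot (c b) (hs_finite_tensor hdot hB (dec m b) (dec m b)).
  split=> //; apply: le_trans tn _; rewrite ger0_norm ?weight_ge0// ler_piMr ?weight_ge0//.
  by rewrite (le_trans (hs_norm_tensor hdot hB _ _))// mulr_ile1.
have [_ /le_trans] := hs_finite_sum hdot (index_enum _) xpredT (fun b => (tf b).1).
apply; apply: le_trans (sum_weight_le1 m); apply: ler_sum => b _.
by case: (tf b).
Qed.

Lemma label_mean_apply_le m h : `|J m h| <= `|h|.
Proof.
rewrite /label_mean fsum_apply; apply: le_trans (ler_norm_sum _ _ _) _.
apply: le_trans (_ : _ <= 1 * `|h|) _; last by rewrite mul1r.
apply: le_trans (ler_wpM2r _ (sum_weight_le1 m)) => //.
rewrite mulr_suml; apply: ler_sum => b _.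
rewrite [X in `|X|]/(fine _ *: (square (dec m b) h)) normrZ ger0_norm ?weight_ge0//.
rewrite ler_wpM2l ?weight_ge0// /tensor normrZ.
apply: le_trans (ler_wpM2r _ (dot_cauchy_schwarz hdot _ _)) _ => //.
by rewrite mulrAC -[leRHS]mul1r ler_wpM2r// mulr_ile1.
Qed.

Lemma label_mean_cvg h : cvg (J ^~ h @ \oo).
Proof.
apply: cauchy_cvg; apply: cauchy_exP => eps e0.
have he : (fun m => 4 * `|h| * err m) @ \oo --> 0.
  by rewrite -[0](mulr0 (4 * `|h|)); apply: cvgMl_tmp; exact: approx_error_cvg0.
have [N _ HN] := cvgr_lt _ he _ e0.
exists (J N h); exists N => // l /= Nl.
rewrite -ball_normE /=; apply: le_lt_trans (label_mean_apply_dist _ _ _) _.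
have := HN N (leqnn N); have := HN l Nl => /=; lra.
Qed.

(** The limit is taken at each vector, in the complete space [H]; convergence in Hilbert-Schmidt
    norm is recovered in [label_mean_lim_dist]. *)
Definition label_mean_lim : H -> H := fun h => lim (J ^~ h @ \oo).
Local Notation I := label_mean_lim.

Lemma label_mean_lim_cvg h : J ^~ h @ \oo --> I h.
Proof. exact: label_mean_cvg. Qed.

Lemma label_mean_lim_linear : linear I.
Proof.
move=> a x y; apply: (@cvg_lim _ (@norm_hausdorff _ H)).
rewrite [X in X @ _ --> _](_ : _ = (fun m => a *: J m x + J m y)).
  by apply: cvgD; [apply: cvgZr|]; exact: label_mean_lim_cvg.
by apply/funext => m; case: (hs_label_mean m) => ->.
Qed.

(** For a fixed finite part [r] the truncated seminorm involves finitely many vectors, so it passes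
    to the limit in [l], together with the bound 2 (err l + err m). The limiting bound does not
    depend on [r], hence holds for the full norm. *)
Lemma label_mean_lim_dist m : hs_finite B (I - J m) /\ nrm (I - J m) <= 2 * err m.
Proof.
have e0 : 0 <= err m.
  by rewrite -lee_fin -approx_errorE; apply: integral_ge0 => w _; rewrite lee_fin.
apply: (hs_norm_le hdot) => [|r fr]; first by rewrite mulr_ge0.
have c1 : (fun l => hs_seminorm dot r (J l - J m)) @ \oo --> hs_seminorm dot r (I - J m).
  rewrite /hs_seminorm /seminorm; apply: continuous_cvg; first exact: sqrt_continuous.
  apply: cvg_sum_seq => e; rewrite hdot.
  rewrite (_ : (fun _ => _) = (fun l => `|(J l - J m) e| ^+ 2)); last first.
    by apply/funext => l; rewrite hdot.
  rewrite expr2; have c : (fun l => `|(J l - J m) e|) @ \oo --> `|(I - J m) e|.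
    by apply: cvg_norm; apply: cvgB; [exact: label_mean_lim_cvg|exact: cvg_cst].
  exact: cvgM.
have c2 : (fun l => 2 * (err l + err m)) @ \oo --> 2 * err m.
  rewrite -[err m in X in _ --> X]add0r; apply: cvgMl_tmp; apply: cvgD.
    exact: approx_error_cvg0.
  exact: cvg_cst.
apply: ler_cvg_to c1 c2 _; apply: nearW => l.
have [Jf Jd] := label_mean_hs_dist l m.
by apply: le_trans (hs_seminorm_le_norm hdot fr Jf) Jd.
Qed.

Lemma label_mean_lim_HS : HS_op B I.
Proof.
split; first exact: label_mean_lim_linear.
  apply: (@linear_continuous_bounded _ _ _ 1); first exact: label_mean_lim_linear.
  move=> h; rewrite mul1r.
  have c : (fun m => `|J m h|) @ \oo --> `|I h|.
    by apply: cvg_norm; exact: label_mean_lim_cvg.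
  apply: (cvgr_to_le c); apply: nearW => m.
  exact: label_mean_apply_le.
have [f0 _] := label_mean_lim_dist 0.
have [_ _ f1] := hs_label_mean 0.
have [] := hs_finiteD hdot f0 f1; by rewrite subrK.
Qed.

Lemma hs_finite_square_diff (u v : H) : hs_finite B (square u - square v).
Proof.
by have [] := hs_finiteB hdot (hs_finite_tensor hdot hB u u) (hs_finite_tensor hdot hB v v).
Qed.

Lemma hs_dist_cvg (S_ : nat -> H -> H) (S U : H -> H) :
    (forall l, hs_finite B (S_ l)) -> hs_finite B S -> hs_finite B U ->
    (fun l => nrm (S_ l - S)) @ \oo --> (0 : R) ->
  (fun l => nrm (S_ l - U)) @ \oo --> nrm (S - U).
Proof.
move=> Slf Sf Uf c; apply/cvgrPdist_le => eps e0.
have [N _ HN] := cvgr_le _ c _ e0; exists N => // l /= Nl.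
have fB S1 S2 : hs_finite B S1 -> hs_finite B S2 -> hs_finite B (S1 - S2).
  by move=> f1 f2; case: (hs_finiteB hdot f1 f2).
have h1 := hs_norm_distD hdot (fB _ _ Sf (Slf l)) (fB _ _ (Slf l) Uf).
have h2 := hs_norm_distD hdot (fB _ _ (Slf l) Sf) (fB _ _ Sf Uf).
have h3 := HN l Nl; rewrite /= in h3.
rewrite -[S - S_ l]opprB hs_normN in h1.
by rewrite ler_norml; apply/andP; split; lra.
Qed.

Lemma square_cvg w : (fun l => nrm (square (q l w) - square (theta w))) @ \oo --> (0 : R).
Proof.
have c : (fun l => 2 * `|q l w - theta w|) @ \oo --> (0 : R).
  rewrite -[0](mulr0 2) -(@normr0 _ H) -(subrr (theta w)); apply: cvgMl_tmp.
  by apply: cvg_norm; apply: cvgB; [exact: dec_cvg|exact: cvg_cst].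
apply: squeeze_cvgr (cvg_cst 0) c; apply: nearW => l.
by rewrite hs_norm_ge0; exact: hs_norm_tensor_diff.
Qed.

Lemma measurable_square_dist m :
  measurable_fun D (fun w => nrm (square (theta w) - square (q m w))).
Proof.
apply: (@measurable_fun_cvg _ _ _ _ (fun l w => nrm (square (q l w) - square (q m w)))).
  move=> l; exact: (labeling_measurable_fun (fun b : F l * F m =>
    nrm (square (dec l b.1) - square (dec m b.2))) mD (labeling_pair (@mL l) (@mL m))).
move=> w _; apply: hs_dist_cvg; last exact: square_cvg.
- by move=> l; exact: hs_finite_tensor.
- exact: hs_finite_tensor.
- exact: hs_finite_tensor.
Qed.

(** The integrand and the tensor square of [theta] are tied on [D] only: in the application [f]
    comes from the angle, and [theta] is the angle set to 0 outside the exceedances. *)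
Variable f : T -> H -> H.
Hypothesis f_square : forall w, D w -> f w = square (theta w).

Lemma measurable_bochner_dist m : measurable_fun D (fun w => nrm (f w - square (q m w))).
Proof.
apply: (eq_measurable_fun _ _ (@measurable_square_dist m)) => w.
by rewrite inE => Dw; rewrite f_square.
Qed.

Lemma bochner_dist_cvg0 :
  (fun m => \int[P]_(w in D) (nrm (f w - square (q m w)))%:E)%E @ \oo --> 0%E.
Proof.
have c0 w : D w -> (fun m => nrm (f w - square (q m w))) @ \oo --> (0 : R).
  move=> Dw; rewrite f_square//.
  rewrite (_ : (fun _ => _) = (fun m => nrm (square (q m w) - square (theta w)))).
    exact: square_cvg.
  by apply/funext => m; rewrite -opprB hs_normN.
have b4 m w : D w -> `|nrm (f w - square (q m w))| <= 4.
  move=> Dw; rewrite f_square// ger0_norm ?hs_norm_ge0//.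
  apply: le_trans (hs_norm_tensor_diff hdot hB (theta1 w) (dec1 m _)) _.
  by have := dist_theta_le2 m w; lra.
have [_] := bounded_convergence P mD measurable_bochner_dist c0 b4.
by rewrite integral0.
Qed.

Lemma label_meanE m : simple_integral P D (fun w => square (q m w)) = J m.
Proof. exact: (simple_integral_labeling P (fun b => square (dec m b)) mD (@mL m)). Qed.

Lemma bochner_simple_label m : bochner_simple (HS_op B) (fun w => square (q m w)).
Proof.
split=> [|v|w]; last exact: HS_op_tensor.
  apply: (@sub_finite_set _ _ ((fun b => square (dec m b)) @` [set: F m])).
    by move=> _ [w _ <-]; exists (L m w).
  by apply: finite_image; exact: finite_finset.
exact: (labeling_preimage [set b | square (dec m b) = v] (@mL m)).
Qed.

Lemma label_mean_lim_bochner : is_bochner_integral P (HS_op B) nrm D f I.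
Proof.
split; first by move=> w Dw; rewrite f_square//; exact: HS_op_tensor.
  exact: label_mean_lim_HS.
exists (fun m w => square (q m w)); split.
- exact: bochner_simple_label.
- exact: measurable_bochner_dist.
- exact: bochner_dist_cvg0.
- have c : (fun m => 2 * err m) @ \oo --> (0 : R).
    by rewrite -[0](mulr0 2); apply: cvgMl_tmp; exact: approx_error_cvg0.
  apply: squeeze_cvgr (cvg_cst 0) c; apply: nearW => m.
  rewrite label_meanE hs_norm_ge0 -opprB hs_normN.
  by case: (label_mean_lim_dist m).
Qed.

Lemma HS_op0 : HS_op B (0 : H -> H).
Proof.
by split=> [a x y|x|]; [rewrite scaler0 addr0|exact: cvg_cst|case: (hs_finite0 B hdot)].
Qed.

(** A joint labeling of [s] and of the [m]-th approximation makes the difference of the two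
    integrals one finite sum, of norm at most the integral of the pointwise distance; the triangle
    inequality then passes through [f]. *)
Lemma simple_integral_dist (s : T -> H -> H) m : bochner_simple (HS_op B) s ->
    measurable_fun D (fun w => nrm (f w - s w)) ->
  hs_finite B (simple_integral P D s - J m) /\
  ((nrm (simple_integral P D s - J m))%:E <=
   \int[P]_(w in D) (nrm (f w - s w))%:E +
   \int[P]_(w in D) (nrm (f w - square (q m w)))%:E)%E.
Proof.
move=> bs ms; have [k [K [g [mK Vg sE]]]] := bochner_simple_labeling bs HS_op0.
have mKL := labeling_pair mK (@mL m).
pose c b := fine (P (D `&` (fun w => (K w, L m w)) @^-1` [set b])).
have c0 b : 0 <= c b by exact: fine_ge0.
have JE : simple_integral P D s - J m =
    \sum_b c b *: (g b.1 - square (dec m b.2)).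
  rewrite -label_meanE sE.
  rewrite (_ : g \o K = (fun b : 'I_k * F m => g b.1) \o (fun w => (K w, L m w)))//.
  rewrite (_ : (fun w => _) =
    (fun b : 'I_k * F m => square (dec m b.2)) \o (fun w => (K w, L m w)))//.
  by rewrite !simple_integral_labeling// -sumrB; apply: eq_bigr => b _; rewrite scalerBr.
have gf b : hs_finite B (g b.1 - square (dec m b.2)).
  have [_ _ gb] := Vg b.1.
  by case: (hs_finiteB hdot gb (hs_finite_tensor hdot hB (dec m b.2) (dec m b.2))).
have cf b : hs_finite B (c b *: (g b.1 - square (dec m b.2))).
  by case: (hs_finiteZ hdot (c b) (gf b)).
have [Sf Sn] := hs_finite_sum hdot (index_enum _) xpredT cf.
rewrite JE; split=> //.
apply: (@le_trans _ _ (\sum_b c b * nrm (g b.1 - square (dec m b.2)))%:E).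
  rewrite lee_fin; apply: le_trans Sn _; apply: ler_sum => b _.
  by case: (hs_finiteZ hdot (c b) (gf b)) => _ /le_trans; apply; rewrite ger0_norm.
rewrite -(labeling_integral P mD mKL (fun b : 'I_k * F m =>
  hs_norm_ge0 B (g b.1 - square (dec m b.2)))).
have n0 (U : H -> H) : (0 <= (nrm U)%:E)%E by rewrite lee_fin hs_norm_ge0.
have m1 : measurable_fun D (fun w => (nrm (f w - s w))%:E) by exact/measurable_EFinP.
have m2 : measurable_fun D (fun w => (nrm (f w - square (q m w)))%:E).
  by apply/measurable_EFinP; exact: measurable_bochner_dist.
rewrite -ge0_integralD//.
apply: ge0_le_integral => //.
- apply/measurable_EFinP; exact: (labeling_measurable_fun (fun b : 'I_k * F m =>
    nrm (g b.1 - square (dec m b.2))) mD mKL).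
- exact: emeasurable_funD.
- move=> w Dw; rewrite -EFinD lee_fin /=.
  have ff : hs_finite B (f w) by rewrite f_square//; exact: hs_finite_tensor.
  have gsf : hs_finite B (g (K w)) by case: (Vg (K w)).
  have [d1 _] := hs_finiteB hdot gsf ff.
  have [d2 _] := hs_finiteB hdot ff (hs_finite_tensor hdot hB (q m w) (q m w)).
  by have := hs_norm_distD hdot d1 d2; rewrite -[g (K w) - f w]opprB hs_normN sE.
Qed.

(** Uniqueness: an admissible value comes with an approximating sequence of its own, and comparing
    the simple integrals of that sequence with [J m] forces the value to be the limit of the
    [J m]. *)
Lemma bochner_integral_label_mean I' : is_bochner_integral P (HS_op B) nrm D f I' ->
  (fun m => nrm (I' - J m)) @ \oo --> (0 : R).
Proof.
move=> [_ [_ _ I'f] [s [bs ms sc sI]]].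
have le m : ((nrm (I' - J m))%:E <=
    \int[P]_(w in D) (nrm (f w - square (q m w)))%:E)%E.
  apply/lee_addgt0Pr => eps e0; have e2 : 0 < eps / 2 by rewrite divr_gt0.
  have [N1 _ H1] := cvgr_lt _ sI _ e2.
  have c2 : nbhs 0%E [set x : \bar R | (x < (eps / 2)%:E)%E].
    by apply: open_nbhs_nbhs; split; [exact: open_ereal_lt_ereal|rewrite /= lte_fin].
  have [N2 _ H2] := sc _ c2.
  pose l := maxn N1 N2.
  have h1 := H1 l (leq_maxl _ _); have h2 := H2 l (leq_maxr _ _).
  rewrite /= in h1 h2.
  have [df dn] := simple_integral_dist m (bs l) (ms l).
  have sf : hs_finite B (simple_integral P D (s l)).
    have [_ _ Jf] := hs_label_mean m.
    by have [] := hs_finiteD hdot df Jf; rewrite subrK.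
  have If : hs_finite B (I' - simple_integral P D (s l)).
    by case: (hs_finiteB hdot I'f sf).
  apply: (@le_trans _ _ (nrm (I' - simple_integral P D (s l)) +
      nrm (simple_integral P D (s l) - J m))%:E).
    by rewrite lee_fin (hs_norm_distD hdot).
  rewrite EFinD -[I' - simple_integral _ _ _]opprB hs_normN addeC.
  apply: le_trans (leeD dn (lexx _)) _.
  rewrite (splitr eps) EFinD [leLHS]addeAC [leLHS]addeC; apply: leeD => //.
  by apply: leeD; [exact: ltW|rewrite lee_fin ltW].
have c : (fun m => (nrm (I' - J m))%:E) @ \oo --> 0%E.
  apply: squeeze_cvge (cvg_cst 0%E) bochner_dist_cvg0.
  by apply: nearW => m; rewrite lee_fin hs_norm_ge0 le.
exact: (fine_cvg c).
Qed.

Lemma bochner_integral_approx :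
  HS_op B (bochner_integral P (HS_op B) nrm D f) /\
  (fun m => nrm (bochner_integral P (HS_op B) nrm D f - J m)) @ \oo --> (0 : R).
Proof.
have : is_bochner_integral P (HS_op B) nrm D f (bochner_integral P (HS_op B) nrm D f).
  apply: (xgetPex 0 (P := [set S | is_bochner_integral P (HS_op B) nrm D f S])).
  by exists I; exact: label_mean_lim_bochner.
by move=> h; split; [case: h|exact: bochner_integral_label_mean].
Qed.

End TensorApproximation.

(** * Concentration *)

Section LiftToHilbertSchmidt.
Context {R : realType} {H : completeNormedModType R}.
Variables (dot : {dot H for idfun}) (B : set H).
Hypothesis hdot : is_inner_product dot.

Lemma ler_hs_seminorm (r r' : seq H) (T : H -> H) : uniq r -> uniq r' ->
  {subset r <= r'} -> hs_seminorm dot r T <= hs_seminorm dot r' T.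
Proof.
move=> ur ur' rr'; rewrite -ler_sqr ?nnegrE ?sqrtr_ge0// !(sqr_hs_seminorm hdot).
rewrite [leRHS](bigID (mem r))/= -[X in _ <= X + _]big_filter.
have pe : perm_eq [seq e <- r' | e \in r] r.
  apply: uniq_perm; rewrite ?filter_uniq// => e; rewrite mem_filter.
  by case er : (e \in r) => //=; rewrite rr'.
by rewrite (perm_big _ pe)/= lerDl sumr_ge0// => e _; rewrite sqr_ge0.
Qed.

(** The union of one good finite part per operator serves them all, since the truncated seminorm
    grows with the list. *)
Lemma hs_norm_lim_uniform (G : finType) (T : G -> H -> H) (eps : R) : 0 < eps ->
    (forall g, hs_finite B (T g)) ->
  exists2 r, finite_part B r & forall g, hs_norm B (T g) - eps <= hs_seminorm dot r (T g).
Proof.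
move=> e0 Tf.
have /choice[r rP] : forall g, exists r, finite_part B r /\
    hs_norm B (T g) - eps <= hs_seminorm dot r (T g).
  by move=> g; have [r fr hr] := hs_norm_lim hdot (Tf g) e0; exists r.
exists (undup (flatten [seq r g | g <- enum G])).
  split; first exact: undup_uniq.
  by move=> e; rewrite mem_undup => /flatten_mapP[g _ er]; case: (rP g) => -[_ /(_ e)] h _; exact: h.
move=> g; have [[ug _] hg] := rP g; apply: le_trans hg _.
apply: ler_hs_seminorm; rewrite ?undup_uniq// => e er.
by rewrite mem_undup; apply/flatten_mapP; exists g; rewrite ?mem_enum.
Qed.

(** The bound [c] is uniform in the finite part. Along parts that reach all the norms up to 1/(m+1),
    the finite sum converges by continuity of [cosh]. *)
Lemma hs_norm_cosh_sum (G : finType) (w : G -> R) (T : G -> H -> H) (lam c : R) :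
    (forall g, hs_finite B (T g)) ->
    (forall r, finite_part B r -> \sum_g w g * cosh (lam * hs_seminorm dot r (T g)) <= c) ->
  \sum_g w g * cosh (lam * hs_norm B (T g)) <= c.
Proof.
move=> Tf hc.
have /choice[r rP] : forall m : nat, exists r, finite_part B r /\
    forall g, hs_norm B (T g) - m.+1%:R^-1 <= hs_seminorm dot r (T g).
  move=> m; have [|r fr hr] := @hs_norm_lim_uniform G T m.+1%:R^-1 _ Tf.
    by rewrite invr_gt0.
  by exists r.
have rc g : (fun m => hs_seminorm dot (r m) (T g)) @ \oo --> hs_norm B (T g).
  have c0 : (fun m => hs_norm B (T g) - m.+1%:R^-1) @ \oo --> hs_norm B (T g).
    rewrite -[X in _ --> X]subr0; apply: cvgB; [exact: cvg_cst|].
    exact: cvg_harmonic.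
  apply: squeeze_cvgr c0 (cvg_cst _); apply: nearW => m.
  by have [fr ->] := rP m; rewrite hs_seminorm_le_norm.
have sc : (fun m => \sum_g w g * cosh (lam * hs_seminorm dot (r m) (T g))) @ \oo -->
    \sum_g w g * cosh (lam * hs_norm B (T g)).
  apply: cvg_sum_seq => g; apply: cvgMl_tmp.
  by apply: continuous_cvg; [exact: continuous_cosh|exact: cvgMl_tmp].
apply: (cvgr_to_le sc); apply: nearW => m.
by apply: hc; case: (rP m).
Qed.

End LiftToHilbertSchmidt.

Section Chernoff.
Context {d : measure_display} {T : measurableType d} {R : realType}.
Variable P : probability T R.

(** Markov's inequality for [cosh (lam * N w)]; the factor 2 comes from [expR_le_cosh]. *)
Lemma cosh_chernoff (N : T -> R) (lam c r : R) :
    measurable_fun setT N -> (forall w, 0 <= N w) -> 0 <= lam -> 0 <= r ->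
    (\int[P]_w (cosh (lam * N w))%:E <= (expR c)%:E)%E ->
  (P [set w | r < N w]%R <= (2 * expR (c - lam * r))%:E)%E.
Proof.
move=> mN N0 l0 r0 hN; set A := [set w | _].
have mA : measurable A.
  by have := mN measurableT _ (measurable_itv `]r, +oo[%R); rewrite setTI preimage_itvoy.
have mc : measurable_fun setT (fun w => cosh (lam * N w)).
  apply: measurableT_comp; last exact: measurable_funM.
  by apply: continuous_measurable_fun; exact: continuous_cosh.
have : ((cosh (lam * r))%:E * P A <= (expR c)%:E)%E.
  apply: le_trans hN; rewrite -[A]setIT -integral_indic// -ge0_integralZl_EFin//.
  - apply: ge0_le_integral => //.
    + by move=> w _; rewrite -EFinM lee_fin mulr_ge0// cosh_ge0.
    + by apply/measurable_EFinP; apply: measurable_funM => //; exact: measurable_indic.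
    + exact/measurable_EFinP.
    + move=> w _; rewrite -EFinM lee_fin indicE.
      case: (boolP (w \in A)) => [/set_mem /= rN|_]; last by rewrite mulr0 cosh_ge0.
      by rewrite mulr1 ler_cosh ?mulr_ge0// ler_wpM2l// ltW.
  - by apply/measurable_EFinP; exact: measurable_indic.
  - exact: cosh_ge0.
have fA : P A \is a fin_num by exact: fin_num_measure.
rewrite -(fineK fA) -EFinM !lee_fin expRB => h.
rewrite mulrA ler_pdivlMr ?expR_gt0//.
have p0 : 0 <= fine (P A) by exact: fine_ge0.
by have := ler_wpM2l p0 (expR_le_cosh (lam * r)); lra.
Qed.

End Chernoff.

Section LabelWeights.
Context {d : measure_display} {T : measurableType d} {R : realType}.
Variable P : probability T R.

Lemma labeling_sum1 (F : finType) (L : T -> F) : labeling L ->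
  \sum_b fine (P (L @^-1` [set b])) = 1.
Proof.
move=> mL; have := labeling_integral P measurableT mL (fun=> ler01).
rewrite integral_cst// mul1e => h.
have [->] := etrans (esym (@probability_setT _ _ _ P)) h.
by apply: eq_bigr => b _; rewrite setTI mulr1.
Qed.

End LabelWeights.

Section Deviations.
Context {d : measure_display} {T : measurableType d} {R : realType}.
Context {H : completeNormedModType R}.
Variables (P : probability T R) (X : T -> H) (n k : nat) (X_ : 'I_n -> T -> H).
Hypothesis hX : random_element X.
Hypothesis hcopies : independent_copies P X X_.
Hypothesis n0 : (0 < n)%N.
Variable t : \bar R.
Hypothesis htail : P (exceedance X t) = (k%:R / n%:R)%:E.

Let exceeds (x : H) : bool := `[< (t < `|x|%:E)%E >].

Definition exceedance_count (w : T) : R := \sum_i (exceeds (X_ i w))%:R.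

Lemma mean_count : n%:R * (k%:R / n%:R) = k%:R :> R.
Proof. by rewrite mulrC divfK// pnatr_eq0 -lt0n. Qed.

Lemma mexceeds : labeling (fun x : borel_space H => exceeds x).
Proof. by apply: labeling_bool; exact: measurable_exceedance. Qed.

(** The real line as a one-dimensional instance, so that the number of exceedances is governed by
    the same exponential bound as the operators. *)
Lemma mul_semi_inner_product : semi_inner_product (fun x y : R^o => x * y : R).
Proof.
split=> [x y|a x y z|x]; first exact: mulrC.
  by rewrite mulrDl -mulrA.
by rewrite -expr2 sqr_ge0.
Qed.

Lemma measurable_count : measurable_fun setT exceedance_count.
Proof.
have mL : labeling (fun w => [ffun i => exceeds (X_ i w)]).
  apply: labeling_ffun => i; apply: random_element_labeling.
    exact: mexceeds.
  by case: hcopies.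
have h := labeling_measurable_fun (fun b : {ffun 'I_n -> bool} => \sum_i (b i)%:R : R)
  measurableT mL.
rewrite (_ : exceedance_count =
    (fun w => \sum_i ([ffun i => exceeds (X_ i w)] i)%:R))//.
by apply/funext => w; apply: eq_bigr => i _; rewrite ffunE.
Qed.

(** The label is the exceedance indicator itself, which equals its square: mean and second moment
    are both k/n, and n draws give the exponent lam^2 k. *)
Lemma count_mgf (lam : R) : 0 <= lam <= 3 / 4 ->
  (\int[P]_w (cosh (lam * `|exceedance_count w - k%:R|))%:E <=
   (expR (lam ^+ 2 * k%:R))%:E)%E.
Proof.
move=> hl; pose p b := fine (P (X @^-1` (exceeds @^-1` [set b]))).
have mL := random_element_labeling mexceeds hX.
have p1 : \sum_b p b = 1 by exact: labeling_sum1 mL.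
have pt : p true = k%:R / n%:R.
  rewrite /p (_ : X @^-1` _ = exceedance X t) ?htail//.
  by apply/seteqP; split => w /= => [/asboolP|h]; last exact/asboolP.
have z1 (b : bool) : seminorm (fun x y : R^o => x * y : R) (b%:R : R^o) <= 1.
  by rewrite /seminorm; case: b; rewrite ?mul0r ?mul1r ?sqrtr0 ?sqrtr1.
have := pinelis_centered mul_semi_inner_product (fun b => fine_ge0 (measure_ge0 P _)) p1 n z1 hl.
rewrite -/p.
have -> : \sum_v p v *: (v%:R : R^o) = k%:R / n%:R.
  by rewrite big_bool/= scaler0 addr0 pt; exact: mulr1.
have -> : \sum_v p v * seminorm (fun x y : R^o => x * y : R) (v%:R : R^o) ^+ 2 = k%:R / n%:R.
  by rewrite big_bool/= pt /seminorm mul0r mul1r sqrtr0 sqrtr1 expr0n expr1n /= mulr1 mulr0 addr0.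
rewrite mulrCA mean_count => h.
pose g (f : {ffun 'I_n -> bool}) := cosh (lam * `|\sum_i (f i)%:R - k%:R|).
rewrite [leLHS](_ : _ = \int[P]_w (g [ffun i => exceeds (X_ i w)])%:E)%E; last first.
  apply: eq_integral => w _; rewrite /g (_ : exceedance_count w =
    \sum_i ([ffun i => exceeds (X_ i w)] i)%:R)//.
  by apply: eq_bigr => i _; rewrite ffunE.
rewrite (integral_independent_labels hcopies mexceeds (g := g)); last first.
  by move=> f; exact: cosh_ge0.
rewrite lee_fin; apply: le_trans h; rewrite le_eqVlt; apply/orP; left; apply/eqP.
apply: eq_bigr => f _; rewrite /g (_ : seminorm _ _ = `|\sum_i (f i)%:R - k%:R|)//.
rewrite /seminorm -expr2 sqrtr_sqr.
rewrite (_ : n%:R *: _ = n%:R * (k%:R / n%:R) :> R)//.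
by rewrite mean_count.
Qed.

End Deviations.

Section TailAngle.
Context {R : realType} {H : completeNormedModType R}.

(** With the value 0 off the exceedances, a sum over a random set of indices becomes a sum of [n]
    independent, identically distributed terms. *)
Definition tail_angle (t : \bar R) (x : H) : H :=
  if `[< (t < `|x|%:E)%E >] then angle x else 0.

Lemma norm_tail_angle_le1 t x : `|tail_angle t x| <= 1.
Proof. by rewrite /tail_angle; case: ifP => _; rewrite ?norm_angle_le1 ?normr0. Qed.

Lemma tail_angle_approximation (dot : {dot H for idfun}) (t : \bar R) :
    is_inner_product dot -> separable_space H ->
  exists (F : nat -> finType) (lab : forall m, H -> F m) (dec : forall m, F m -> H),
    [/\ forall m b, measurable (lab m @^-1` [set b] : set (borel_space H)),
        forall m b, `|dec m b| <= 1,
        forall x, (fun m => dec m (lab m x)) @ \oo --> tail_angle t x &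
        forall m x, ~ (t < `|x|%:E)%E -> dec m (lab m x) = 0].
Proof.
move=> hdot hsep.
have [F [lab [dec [mlab dec1 dc d0]]]] := finite_approximation hsep
  (@norm_angle_le1 R H) (measurable_angle_closer hdot t).
exists F, lab, dec; split=> // [x|m x nt]; last by apply: d0 => -[].
have [tx|ntx] := pselect (t < `|x|%:E)%E; last first.
  rewrite /tail_angle asboolF// (_ : (fun _ => _) = cst 0); first exact: cvg_cst.
  by apply/funext => m; apply: d0 => -[].
(* The point 0 exceeds a negative [t]; its angle is 0 by convention, and so are the approximations
   there. *)
rewrite /tail_angle asboolT//; have [->|x0] := eqVneq x 0.
  rewrite angle0 (_ : (fun _ => _) = cst 0); first exact: cvg_cst.
  by apply/funext => m; apply: d0 => -[_]; rewrite eqxx.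
exact: dc.
Qed.

End TailAngle.

Section CovarianceDeviation.
Context {R : realType} {H : completeNormedModType R}.
Variables (dot : {dot H for idfun}) (B : set H).
Hypothesis hdot : is_inner_product dot.
Hypothesis hsep : separable_space H.
Hypothesis hB : orthonormal_basis dot B.
Context {d : measure_display} {T : measurableType d}.
Variables (P : probability T R) (X : T -> H) (n k : nat) (X_ : 'I_n -> T -> H).
Hypothesis hX : random_element X.
Hypothesis hcopies : independent_copies P X X_.
Hypothesis n0 : (0 < n)%N.
Variable t : \bar R.
Hypothesis htail : P (exceedance X t) = (k%:R / n%:R)%:E.

Local Notation nrm := (hs_norm B).
Local Notation square h := (tensor dot h h).
Local Notation E := (exceedance X t).

Definition tail_integral : H -> H :=
  bochner_integral P (HS_op B) (hs_norm B) E (fun w => square (angle (X w))).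

Definition covariance_deviation (w : T) : H -> H :=
  \sum_i square (tail_angle t (X_ i w)) - n%:R *: tail_integral.

Lemma exceedance_measurable : measurable E.
Proof.
have := hX measurableT (measurable_exceedance t (H := H)); rewrite setTI; exact.
Qed.
Local Notation mE := exceedance_measurable.

Section Approximants.
Variables (F : nat -> finType) (lab : forall m, H -> F m) (dec : forall m, F m -> H).
Arguments dec : clear implicits.
Hypothesis mlab : forall m b, measurable (lab m @^-1` [set b] : set (borel_space H)).
Arguments mlab : clear implicits.
Hypothesis dec1 : forall m b, `|dec m b| <= 1.
Arguments dec1 : clear implicits.
Hypothesis dec_cvg : forall x, (fun m => dec m (lab m x)) @ \oo --> tail_angle t x.
Hypothesis dec0 : forall m x, ~ (t < `|x|%:E)%E -> dec m (lab m x) = 0.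

Local Notation J := (label_mean dot P E (fun m w => lab m (X w)) dec).

Let mL m : labeling (fun w => lab m (X w)).
Proof. exact: (random_element_labeling (mlab m) hX). Qed.

Let p m b := fine (P (X @^-1` (lab m @^-1` [set b]))).
Arguments p : clear implicits.

(** A label decoded to a nonzero vector is attained only on exceedances, so intersecting with [E]
    changes nothing; for the other labels the tensor is 0. Hence [J m] is the mean of one summand
    under the law of its label, which is the centering that [pinelis_centered] uses. *)
Lemma tail_weight m b :
  fine (P (E `&` (fun w => lab m (X w)) @^-1` [set b])) *: square (dec m b) =
  p m b *: square (dec m b).
Proof.
have [->|b0] := eqVneq (dec m b) 0.
  rewrite (_ : square 0 = 0) ?scaler0//.
  by apply/funext => h; rewrite /tensor scaler0.
congr (fine (P _) *: _); apply/seteqP; split => w /=; first by case.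
by move=> wb; split=> //; apply: contra_notP (negP b0) => nt; rewrite -wb dec0.
Qed.

Lemma label_mean_weight m : J m = \sum_b p m b *: square (dec m b).
Proof. by apply: eq_bigr => b _; exact: tail_weight. Qed.

Lemma sum_tail_weight m :
  \sum_b fine (P (E `&` (fun w => lab m (X w)) @^-1` [set b])) = k%:R / n%:R.
Proof.
have := labeling_integral P mE (@mL m) (fun=> ler01).
rewrite integral_cst//; last exact: mE.
rewrite mul1e => /(etrans (esym htail)) [->].
by apply: eq_bigr => b _; rewrite mulr1.
Qed.

Lemma hs_square_le1 (h : H) : `|h| <= 1 -> nrm (square h) <= 1.
Proof. by move=> h1; rewrite (le_trans (hs_norm_tensor hdot hB _ _))// mulr_ile1. Qed.

Lemma hs_finite_dev (a : 'I_n -> H) (S : H -> H) : hs_finite B S ->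
  hs_finite B (\sum_i square (a i) - n%:R *: S).
Proof.
move=> Sf.
have [f1 _] := hs_finite_sum hdot (index_enum _) xpredT
  (fun i => hs_finite_tensor hdot hB (a i) (a i)).
have [f2 _] := hs_finiteZ hdot n%:R Sf.
by case: (hs_finiteB hdot f1 f2).
Qed.

Lemma hs_finite_J m : hs_finite B (J m).
Proof. by case: (hs_label_mean hdot hB P E (fun m w => lab m (X w)) dec m). Qed.

(** Only labels with a nonzero vector contribute to the second moment, and their total weight is at
    most P(E) = k/n. This is what puts [k] rather than [n] in the exponent. *)
Lemma approximant_mgf (lam : R) m : 0 <= lam <= 3 / 4 ->
  (\int[P]_w (cosh (lam * nrm (\sum_i square (dec m (lab m (X_ i w))) - n%:R *: J m)))%:E <=
   (expR (lam ^+ 2 * k%:R))%:E)%E.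
Proof.
move=> hl.
pose g (f : {ffun 'I_n -> F m}) :=
  cosh (lam * nrm (\sum_i square (dec m (f i)) - n%:R *: J m)).
rewrite [leLHS](_ : _ = \int[P]_w (g [ffun i => lab m (X_ i w)])%:E)%E; last first.
  apply: eq_integral => w _; rewrite /g.
  rewrite (_ : \sum_i square (dec m (lab m (X_ i w))) =
    \sum_i square (dec m ([ffun i => lab m (X_ i w)] i)))//.
  by apply: eq_bigr => i _; rewrite ffunE.
rewrite (integral_independent_labels hcopies (mlab m) (g := g)); last first.
  by move=> f; exact: cosh_ge0.
rewrite lee_fin /g.
apply: (hs_norm_cosh_sum hdot (B := B) (T := fun f : {ffun 'I_n -> F m} =>
    \sum_i square (dec m (f i)) - n%:R *: J m)) => [f|r fr].
  by apply: (@hs_finite_dev (fun i => dec m (f i))); exact: hs_finite_J.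
have z1 b : seminorm (hs_ip dot r) (square (dec m b)) <= 1.
  apply: le_trans (hs_square_le1 (dec1 m b)).
  by apply: (hs_seminorm_le_norm hdot fr); exact: hs_finite_tensor.
have := pinelis_centered (hs_ip_semi_inner_product hdot r)
  (fun b => fine_ge0 (measure_ge0 P _)) (labeling_sum1 P (@mL m)) n z1 hl.
rewrite label_mean_weight => /le_trans; apply.
rewrite ler_expR mulrCA ler_wpM2l ?sqr_ge0//.
rewrite -(mean_count k n0) ler_wpM2l// -(sum_tail_weight m); apply: ler_sum => b _.
have [b0|b0] := eqVneq (dec m b) 0.
  rewrite b0 (_ : square 0 = 0); last by apply/funext => h; rewrite /tensor scaler0.
  rewrite (seminorm0 (hs_ip_semi_inner_product hdot r)) expr0n mulr0.
  exact: fine_ge0.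
rewrite [Y in fine (P Y) * _](_ : _ = E `&` (fun w => lab m (X w)) @^-1` [set b]); last first.
  apply/seteqP; split => w /=; last by case.
  by move=> wb; split=> //; apply: contra_notP (negP b0) => nt; rewrite -wb dec0.
rewrite ler_piMr ?fine_ge0// -[leRHS](expr1n _ 2) ler_sqr ?nnegrE ?sqrtr_ge0//.
Qed.

Lemma tail_integral_approx :
  HS_op B tail_integral /\ (fun m => nrm (tail_integral - J m)) @ \oo --> (0 : R).
Proof.
have h := bochner_integral_approx hdot hB P mE (@mL) dec1
  (fun w => norm_tail_angle_le1 t (X w)) (fun w => @dec_cvg (X w)).
apply: h => w Ew.
by rewrite /tail_angle asboolT.
Qed.

Lemma approximant_cvg w :
  (fun m => nrm (\sum_i square (dec m (lab m (X_ i w))) - n%:R *: J m)) @ \oo -->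
  nrm (covariance_deviation w).
Proof.
have [[_ _ If] Ic] := tail_integral_approx.
pose S_ m := \sum_i square (dec m (lab m (X_ i w))) - n%:R *: J m.
have S_f m : hs_finite B (S_ m).
  by apply: (@hs_finite_dev (fun i => dec m (lab m (X_ i w)))); exact: hs_finite_J.
have Sf : hs_finite B (covariance_deviation w).
  by apply: (@hs_finite_dev (fun i => tail_angle t (X_ i w))).
have [f0 _] := hs_finite0 B hdot.
suff c : (fun m => nrm (S_ m - covariance_deviation w)) @ \oo --> (0 : R).
  have := hs_dist_cvg hdot S_f Sf f0 c; rewrite subr0.
  by rewrite (_ : (fun l => nrm (S_ l - 0)) = (fun l => nrm (S_ l)))//;
    apply/funext => l; rewrite subr0.
have cb : (fun m => \sum_i nrm (square (dec m (lab m (X_ i w))) - square (tail_angle t (X_ i w)))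
    + n%:R * nrm (tail_integral - J m)) @ \oo --> (0 : R).
  rewrite -[X in _ --> X]addr0; apply: cvgD; last first.
    by rewrite -[X in _ --> X](mulr0 n%:R); apply: cvgMl_tmp.
  rewrite [X in _ --> X](_ : 0 = \sum_(i < n) 0); last by rewrite big1.
  apply: cvg_sum_seq => i.
  exact: (square_cvg hdot hB dec1 (fun w => norm_tail_angle_le1 t (X_ i w))
    (fun w => @dec_cvg (X_ i w)) w).
apply: squeeze_cvgr (cvg_cst 0) cb; apply: nearW => m.
rewrite hs_norm_ge0/=.
have df i : hs_finite B (square (dec m (lab m (X_ i w))) - square (tail_angle t (X_ i w))).
  exact: hs_finite_square_diff.
have [sf sn] := hs_finite_sum hdot (index_enum _) xpredT df.
have [e1 _] := hs_finiteB hdot If (hs_finite_J m).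
have [e2 en] := hs_finiteZ hdot n%:R e1.
have -> : S_ m - covariance_deviation w =
    \sum_i (square (dec m (lab m (X_ i w))) - square (tail_angle t (X_ i w))) +
    n%:R *: (tail_integral - J m).
  rewrite /S_ /covariance_deviation sumrB scalerBr opprB addrACA [RHS]addrACA.
  by congr (_ + _); rewrite addrC.
have [_ h] := hs_finiteD hdot sf e2; apply: le_trans h _.
by apply: lerD => //; apply: le_trans en _; rewrite ger0_norm.
Qed.

Lemma approximant_measurable m : measurable_fun setT
  (fun w => nrm (\sum_i square (dec m (lab m (X_ i w))) - n%:R *: J m)).
Proof.
have mLL : labeling (fun w => [ffun i => lab m (X_ i w)]).
  apply: labeling_ffun => i; apply: (random_element_labeling (mlab m)).
  by case: hcopies.
pose g (f : {ffun 'I_n -> F m}) : R := nrm (\sum_i square (dec m (f i)) - n%:R *: J m).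
rewrite (_ : (fun w => _) = (fun w => g [ffun i => lab m (X_ i w)])).
  exact: (labeling_measurable_fun g measurableT mLL).
apply/funext => w; rewrite /g (_ : \sum_i square (dec m (lab m (X_ i w))) =
  \sum_i square (dec m ([ffun i => lab m (X_ i w)] i)))//.
by apply: eq_bigr => i _; rewrite ffunE.
Qed.

Lemma approximant_le m w :
  nrm (\sum_i square (dec m (lab m (X_ i w))) - n%:R *: J m) <= n%:R + n%:R.
Proof.
have [sf sn] := hs_finite_sum hdot (index_enum 'I_n) xpredT
  (fun i => hs_finite_tensor hdot hB (dec m (lab m (X_ i w))) (dec m (lab m (X_ i w)))).
have [e2 en] := hs_finiteZ hdot n%:R (hs_finite_J m).
have [_ h] := hs_finiteB hdot sf e2; apply: le_trans h _; apply: lerD.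
  apply: le_trans sn _; rewrite -[leRHS]mulr1 -[n in leRHS]card_ord mulr_natl -sumr_const.
  by apply: ler_sum => i _; exact: hs_square_le1.
apply: le_trans en _; rewrite ger0_norm// ler_piMr//.
exact: (hs_norm_label_mean_le1 hdot hB P mE (@mL) dec1).
Qed.

End Approximants.

Lemma tail_integral_HS : HS_op B tail_integral.
Proof.
have [F [lab [dec [mlab dec1 dc d0]]]] := tail_angle_approximation t hdot hsep.
by case: (tail_integral_approx (lab := lab) (dec := dec)).
Qed.

(** Bounded convergence from the finitely-valued approximations, whose norms are at most 2n.
    Measurability of the norm comes from the same limit. *)
Lemma covariance_mgf (lam : R) : 0 <= lam <= 3 / 4 ->
  measurable_fun setT (fun w => nrm (covariance_deviation w)) /\
  (\int[P]_w (cosh (lam * nrm (covariance_deviation w)))%:E <=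
   (expR (lam ^+ 2 * k%:R))%:E)%E.
Proof.
move=> hl; have /andP[l0 _] := hl.
have [F [lab [dec [mlab dec1 dc d0]]]] := tail_angle_approximation t hdot hsep.
pose N m w := nrm (\sum_i square (dec m (lab m (X_ i w))) -
  n%:R *: label_mean dot P E (fun m w => lab m (X w)) dec m).
have mS m : measurable_fun setT (N m) by exact: approximant_measurable.
have cS w : N ^~ w @ \oo --> nrm (covariance_deviation w) by exact: approximant_cvg.
split; first by apply: (measurable_fun_cvg mS) => w _; exact: cS.
have mc m : measurable_fun setT (fun w => cosh (lam * N m w)).
  apply: measurableT_comp; last by apply: measurable_funM => //; exact: mS.
  by apply: continuous_measurable_fun; exact: continuous_cosh.
have cc w : setT w -> (fun m => cosh (lam * N m w)) @ \oo -->
    cosh (lam * nrm (covariance_deviation w)).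
  move=> _; apply: continuous_cvg; first exact: continuous_cosh.
  by apply: cvgMl_tmp; exact: cS.
have cb m w : setT w -> `|cosh (lam * N m w)| <= cosh (lam * (n%:R + n%:R)).
  move=> _; rewrite ger0_norm ?cosh_ge0// ler_cosh ?mulr_ge0 ?hs_norm_ge0//.
  by rewrite ler_wpM2l//; exact: approximant_le.
have [_ h] := bounded_convergence P measurableT mc cc cb.
rewrite -(cvg_lim _ h)//; apply: lime_le; first by apply/cvg_ex; eexists; exact: h.
by apply: nearW => m; exact: approximant_mgf.
Qed.

End CovarianceDeviation.

(** * Order statistics *)

Section Decomposition.
Context {R : realType} {H : completeNormedModType R}.
Variables (dot : {dot H for idfun}) (B : set H).
Hypothesis hdot : is_inner_product dot.
Hypothesis hsep : separable_space H.
Hypothesis hB : orthonormal_basis dot B.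
Context {d : measure_display} {T : measurableType d}.
Variables (P : probability T R) (X : T -> H) (n k : nat) (X_ : 'I_n -> T -> H).
Hypothesis hX : random_element X.
Hypothesis hcopies : independent_copies P X X_.
Hypothesis kn : (k <= n)%N.
Variable sigma : T -> 'S_n.
Hypothesis hsigma : sorts_norms X_ sigma.
Variable t : \bar R.
Hypothesis htail : P (exceedance X t) = (k%:R / n%:R)%:E.

Local Notation nrm := (hs_norm B).
Local Notation square h := (tensor dot h h).

Lemma square_tail_angle x :
  square (tail_angle t x) = (`[< (t < `|x|%:E)%E >])%:R *: square (angle x).
Proof.
rewrite /tail_angle; case: ifP => _; first by rewrite scale1r.
by rewrite scale0r; apply/funext => h; rewrite /tensor scaler0.
Qed.

Lemma sum_top : \sum_(i < n) ((i < k)%N)%:R = k%:R :> R.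
Proof.
transitivity (\sum_(i < n | (i < k)%N) (1 : R)).
  by rewrite [RHS]big_mkcond/=; apply: eq_bigr => i _; case: ifP.
by rewrite -(big_ord_widen n (fun=> 1) kn) sumr_const card_ord.
Qed.

(* In sorted order both the [k] largest norms and the exceedances of [t] form
   initial segments, so one of the two contains the other. *)
Lemma top_exceedance_dist w :
  nrm (\sum_(i < n | (i < k)%N) square (angle (X_ (sigma w i) w)) -
       \sum_i square (tail_angle t (X_ i w))) <=
  `|exceedance_count X_ t w - k%:R|.
Proof.
pose e (i : 'I_n) : R := (`[< (t < `|X_ (sigma w i) w|%:E)%E >])%:R.
pose a (i : 'I_n) : R := ((i < k)%N)%:R.
have countE : exceedance_count X_ t w = \sum_i e i.
  by rewrite /exceedance_count (reindex_inj (@perm_inj _ (sigma w))).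
have -> : \sum_(i < n | (i < k)%N) square (angle (X_ (sigma w i) w)) -
       \sum_i square (tail_angle t (X_ i w)) =
       \sum_i (a i - e i) *: square (angle (X_ (sigma w i) w)).
  rewrite (reindex_inj (@perm_inj _ (sigma w)) (F := fun i => square (tail_angle t (X_ i w)))).
  rewrite big_mkcond -sumrB; apply: eq_bigr => i _.
  rewrite square_tail_angle scalerBl; congr (_ - _).
  by rewrite /a; case: ifP => _; rewrite ?scale1r ?scale0r.
pose c i := (a i - e i) *: square (angle (X_ (sigma w i) w)).
have cf i : hs_finite B (c i) /\ nrm (c i) <= `|a i - e i|.
  have [cf cn] := hs_finiteZ hdot (a i - e i)
    (hs_finite_tensor hdot hB (angle (X_ (sigma w i) w)) (angle (X_ (sigma w i) w))).
  split=> //; apply: le_trans cn _; rewrite ler_piMr//.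
  by apply: (hs_square_le1 hdot hB); exact: norm_angle_le1.
have [_ /le_trans] := hs_finite_sum hdot (index_enum _) xpredT (fun i => (cf i).1).
apply; apply: (@le_trans _ _ (\sum_i `|a i - e i|)).
  by apply: ler_sum => i _; case: (cf i).
(* As one segment contains the other, all the differences [a i - e i] have the same sign, so the sum
   of absolute values is the absolute value of the sum. *)
rewrite countE -sum_top -sumrB le_eqVlt; apply/orP; left; apply/eqP.
have down (i j : 'I_n) : (i <= j)%N -> (t < `|X_ (sigma w j) w|%:E)%E ->
    (t < `|X_ (sigma w i) w|%:E)%E.
  by move=> ij /lt_le_trans; apply; rewrite lee_fin; case: hsigma => _; exact.
have [[i [ik ni]]|all_e] := pselect (exists i : 'I_n, (i < k)%N /\
    ~ (t < `|X_ (sigma w i) w|%:E)%E).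
  have le_ea j : e j <= a j.
    rewrite /e /a; case: asboolP => // ej; rewrite (_ : (j < k)%N)//.
    by apply: ltn_trans ik; rewrite ltnNge; apply/negP => ij; apply: ni; exact: down ij ej.
  rewrite (eq_bigr (fun j => a j - e j)); last first.
    by move=> j _; rewrite ger0_norm// subr_ge0.
  have : \sum_j (e j - a j) <= 0 by apply: sumr_le0 => j _; rewrite subr_le0.
  move=> /ler0_norm ->; rewrite -sumrN; apply: eq_bigr => j _; exact/esym/opprB.
have le_ae j : a j <= e j.
  rewrite /e /a; case: (ltnP j k) => // jk; rewrite asboolT//.
  by apply: contrapT => nj; apply: all_e; exists j.
rewrite (eq_bigr (fun j => e j - a j)); last first.
  by move=> j _; rewrite distrC ger0_norm// subr_ge0.
have : 0 <= \sum_j (e j - a j) by apply: sumr_ge0 => j _; rewrite subr_ge0.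
by move=> /ger0_norm ->.
Qed.

Lemma angular_covarianceE :
  angular_covariance P dot B X t = k%:R^-1 *: (n%:R *: tail_integral dot B P X t).
Proof.
rewrite /angular_covariance htail/= scalerA; congr (_ *: _).
by rewrite invf_div mulrC.
Qed.

(** Up to the factor 1/k, the sum of tensors over the exceedances is inserted between the empirical
    covariance and the conditional one. *)
Lemma covariance_dist w :
  nrm (empirical_angular_covariance dot X_ sigma k w - angular_covariance P dot B X t) <=
  (`|exceedance_count X_ t w - k%:R| + nrm (covariance_deviation dot B P X X_ t w)) / k%:R.
Proof.
have [_ _ If] := tail_integral_HS hdot hsep hB P hX t.
have [f1 _] := hs_finite_sum hdot (index_enum 'I_n) (fun i : 'I_n => (i < k)%N)
  (fun i => hs_finite_tensor hdot hB (angle (X_ (sigma w i) w)) (angle (X_ (sigma w i) w))).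
have [f2 _] := hs_finite_sum hdot (index_enum 'I_n) xpredT
  (fun i => hs_finite_tensor hdot hB (tail_angle t (X_ i w)) (tail_angle t (X_ i w))).
have [f3 _] := hs_finiteZ hdot n%:R If.
have [g1 _] := hs_finiteB hdot f1 f2.
have [g2 _] := hs_finiteB hdot f2 f3.
have [g3 g3n] := hs_finiteD hdot g1 g2.
rewrite angular_covarianceE /empirical_angular_covariance -scalerBr.
rewrite subrKA in g3 g3n.
have [_ h] := hs_finiteZ hdot k%:R^-1 g3.
apply: le_trans h _; rewrite ger0_norm ?invr_ge0// mulrC ler_wpM2r ?invr_ge0//.
by apply: le_trans g3n _; rewrite lerD2r; exact: top_exceedance_dist.
Qed.

Lemma measurable_covariance_dist : measurable_fun setT
  (fun w => nrm (empirical_angular_covariance dot X_ sigma k w -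
                 angular_covariance P dot B X t)).
Proof.
(* At the threshold -oo every point is an exceedance, so this approximates the angle itself. *)
have [F [lab [dec [mlab dec1 dc _]]]] := tail_angle_approximation -oo hdot hsep.
set C := angular_covariance P dot B X t.
have Cf : hs_finite B C.
  rewrite /C angular_covarianceE.
  have [_ _ If] := tail_integral_HS hdot hsep hB P hX t.
  have [f1 _] := hs_finiteZ hdot n%:R If.
  by case: (hs_finiteZ hdot k%:R^-1 f1).
have angleE x : tail_angle -oo x = angle x.
  by rewrite /tail_angle asboolT// ltNyr.
pose S (b : 'I_n -> H) : H -> H := k%:R^-1 *: \sum_(i < n | (i < k)%N) square (b i).
have Sf b : hs_finite B (S b).
  have [f1 _] := hs_finite_sum hdot (index_enum 'I_n) (fun i : 'I_n => (i < k)%N)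
    (fun i => hs_finite_tensor hdot hB (b i) (b i)).
  by case: (hs_finiteZ hdot k%:R^-1 f1).
pose b m w i := dec m (lab m (X_ (sigma w i) w)).
have mm m : measurable_fun setT (fun w => nrm (S (b m w) - C)).
  have mlabX : labeling (fun w => [ffun i => lab m (X_ i w)]).
    apply: labeling_ffun => i; apply: (random_element_labeling (mlab m)).
    by case: hcopies.
  (* The permutation takes finitely many values, so it serves as a second label. *)
  have mL : labeling (fun w => ([ffun i => lab m (X_ i w)], sigma w)).
    by apply: labeling_pair => //; case: hsigma.
  pose g (c : {ffun 'I_n -> F m} * 'S_n) : R := nrm (S (fun i => dec m (c.1 (c.2 i))) - C).
  rewrite (_ : (fun w => _) = (fun w => g ([ffun i => lab m (X_ i w)], sigma w))).
    exact: (labeling_measurable_fun g measurableT mL).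
  apply/funext => w; rewrite /g (_ : b m w =
    (fun i => dec m (([ffun i => lab m (X_ i w)], sigma w).1 (([ffun i => lab m (X_ i w)], sigma w).2 i))))//.
  by apply/funext => i; rewrite /= ffunE.
apply: (measurable_fun_cvg mm) => w _.
rewrite (_ : empirical_angular_covariance _ _ _ _ _ = S (fun i => angle (X_ (sigma w i) w)))//.
apply: (hs_dist_cvg hdot (fun m => Sf (b m w)) (Sf _) Cf).
pose s m i := nrm (square (b m w i) - square (angle (X_ (sigma w i) w))).
have sc : (fun m => k%:R^-1 * \sum_(i < n) s m i) @ \oo --> (0 : R).
  rewrite -[X in _ --> X](mulr0 k%:R^-1); apply: cvgMl_tmp.
  rewrite [X in _ --> X](_ : 0 = \sum_(i < n) 0); last by rewrite big1.
  apply: cvg_sum_seq => i; rewrite /s -angleE.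
  exact: (square_cvg hdot hB dec1 (fun w => norm_tail_angle_le1 -oo (X_ (sigma w i) w))
    (fun w => @dc (X_ (sigma w i) w)) w).
apply: squeeze_cvgr (cvg_cst 0) sc; apply: nearW => m.
rewrite hs_norm_ge0/= /S -scalerBr -sumrB.
have df i : hs_finite B (square (b m w i) - square (angle (X_ (sigma w i) w))).
  exact: hs_finite_square_diff.
have [f1 fn] := hs_finite_sum hdot (index_enum 'I_n) (fun i : 'I_n => (i < k)%N) df.
have [_ h] := hs_finiteZ hdot k%:R^-1 f1.
apply: le_trans h _; rewrite ger0_norm ?invr_ge0// ler_wpM2l ?invr_ge0//.
apply: le_trans fn _; rewrite big_mkcond; apply: ler_sum => i _.
by case: ifP => // _; exact: hs_norm_ge0.
Qed.

End Decomposition.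

(** * Optimization of the Chernoff parameter *)

Section Constants.
Context {R : realType}.
Implicit Types (s l r : R).

(** The minimizer for r = 2 s l is [l / s], with value - l^2. When it exceeds 3/4, take 3/4 instead:
    the extra term of [r] contributes exactly - l^2, and s < (4/3) l makes (9/16) s^2 smaller than
    (3/2) s l. *)
Lemma chernoff_parameter s l r : 0 < s -> 0 <= l -> 2 * s * l + 4 / 3 * l ^+ 2 <= r ->
  exists2 lam, 0 <= lam <= 3 / 4 & lam ^+ 2 * s ^+ 2 - lam * r <= - l ^+ 2.
Proof.
move=> s0 l0 hr; have [ls|sl] := leP l (3 / 4 * s).
  have q0 : 0 <= l / s by rewrite divr_ge0// ltW.
  exists (l / s); first by rewrite q0 ler_pdivrMr.
  have := ler_wpM2l q0 hr.
  have -> : l / s * (2 * s * l + 4 / 3 * l ^+ 2) = 2 * l ^+ 2 + l / s * (4 / 3 * l ^+ 2).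
    by field; rewrite gt_eqF.
  have -> : (l / s) ^+ 2 * s ^+ 2 = l ^+ 2 by field; rewrite gt_eqF.
  have : 0 <= l / s * (4 / 3 * l ^+ 2) by rewrite !mulr_ge0// ?invr_ge0 ?sqr_ge0 ?ltW.
  lra.
exists (3 / 4); first by apply/andP; split; lra.
have := ler_wpM2l (ltW s0) (ltW sl); nra.
Qed.

Lemma deviation_exponent (kappa delta : R) : 0 < kappa -> 0 < delta -> delta < 1 ->
  exists2 lam, 0 <= lam <= 3 / 4 &
    2 * expR (lam ^+ 2 * kappa - lam *
      (Num.sqrt kappa * (1 + 4 * Num.sqrt (ln (2 / delta))) + 8 / 3 * ln (2 / delta)))
    < delta / 2.
Proof.
move=> k0 d0 d1; set L := ln (2 / delta).
have dE : delta / 2 = expR (- L) by rewrite expRN lnK ?invf_div// posrE divr_gt0.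
have L2 : ln 2 < L.
  by rewrite ltr_ln ?posrE ?divr_gt0// ltr_pdivlMr// gtr_pMr.
have l20 : 0 < ln 2 :> R by rewrite ln_gt0// ltr1n.
have L0 : 0 <= L by lra.
set r := Num.sqrt kappa * _ + _.
have s0 : 0 < Num.sqrt kappa by rewrite sqrtr_gt0.
(* Half of [r] already yields the exponent - L, so [r] yields - 2 L. One L gives delta / 2 and the
   other absorbs the factor 2, strictly, because delta < 1 gives ln 2 < L. *)
have [|lam hl] := @chernoff_parameter (Num.sqrt kappa) (Num.sqrt L) (r / 2) s0 (sqrtr_ge0 _).
  by rewrite /r sqr_sqrtr//; lra.
rewrite !sqr_sqrtr ?(ltW k0)// => h; exists lam => //.
rewrite dE -{1}[2]lnK ?posrE// -expRD ltr_expR.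
have : 0 <= lam ^+ 2 * kappa by rewrite mulr_ge0 ?sqr_ge0// ltW.
lra.
Qed.

(** Here the factor 2 is absorbed in the logarithm, as 2 exp (- ln (4 / delta)) = delta / 2, and
    sqrt 8 >= 2 leaves room for [chernoff_parameter]. *)
Lemma count_exponent (kappa delta : R) : 0 < kappa -> 0 < delta -> delta < 1 ->
  exists2 lam, 0 <= lam <= 3 / 4 &
    2 * expR (lam ^+ 2 * kappa - lam *
      (Num.sqrt kappa * Num.sqrt (8 * ln (4 / delta)) + 4 / 3 * ln (4 / delta)))
    <= delta / 2.
Proof.
move=> k0 d0 d1; set M := ln (4 / delta).
have dE : delta / 2 = 2 * expR (- M).
  by rewrite expRN lnK ?invf_div ?posrE ?divr_gt0//; lra.
have M0 : 0 <= M.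
  by rewrite ln_ge0// ler_pdivlMr// mul1r; lra.
set r := Num.sqrt kappa * _ + _.
have s0 : 0 < Num.sqrt kappa by rewrite sqrtr_gt0.
have [|lam hl] := @chernoff_parameter (Num.sqrt kappa) (Num.sqrt M) r s0 (sqrtr_ge0 _).
  rewrite /r sqr_sqrtr// lerD2r [2 * _]mulrC -mulrA ler_wpM2l ?(ltW s0)//.
  rewrite -ler_sqr ?nnegrE ?sqrtr_ge0 ?mulr_ge0 ?sqrtr_ge0//.
  by rewrite exprMn !sqr_sqrtr ?mulr_ge0//; lra.
rewrite !sqr_sqrtr ?(ltW k0)// => h; exists lam => //.
by rewrite dE ler_pM2l// ler_expR.
Qed.

End Constants.

Theorem theorem4p2
  (R : realType) (H : completeNormedModType R) (dot : {dot H for idfun})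
  (hdot : is_inner_product dot) (hsep : separable_space H)
  (B : set H) (hB : orthonormal_basis dot B)
  (d : measure_display) (T : measurableType d) (P : probability T R)
  (X : T -> H) (hX : random_element X)
  (alpha : R) (halpha : 0 < alpha) (hRV : regularly_varying P X alpha)
  (n k : nat) (hk1 : (1 <= k)%N) (hkn : (k <= n)%N)
  (X_ : 'I_n -> T -> H) (hcopies : independent_copies P X X_)
  (sigma : T -> 'S_n) (hsigma : sorts_norms X_ sigma)
  (t : \bar R)
  (ht : t = quantile P (fun w => `|X w|) (1 - k%:R / n%:R))
  (htail : P (exceedance X t) = (k%:R / n%:R)%:E)
  (delta : R) (hdelta0 : 0 < delta) (hdelta1 : delta < 1) :
  ((1 - delta)%:E < P [set w |
    (hs_norm B (empirical_angular_covariance dot X_ sigma k w -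
                angular_covariance P dot B X t)
     <= (1 + 4 * Num.sqrt (ln (2 / delta)) + Num.sqrt (8 * ln (4 / delta)))
          / Num.sqrt k%:R
        + (8 * ln (2 / delta) + 4 * ln (4 / delta)) / (3 * k%:R))%R])%E.
Proof.
have n0 : (0 < n)%N by exact: leq_trans hk1 hkn.
have kp : 0 < k%:R :> R by rewrite ltr0n.
have sp : 0 < Num.sqrt k%:R :> R by rewrite sqrtr_gt0.
set bound := _ + _ / (3 * _); set good := [set w | _].
(* The bound times k is split into [r1], allotted to the centered sum of operators, and [r2],
   allotted to the number of exceedances. *)
pose r1 : R := Num.sqrt k%:R * (1 + 4 * Num.sqrt (ln (2 / delta))) + 8 / 3 * ln (2 / delta).
pose r2 : R := Num.sqrt k%:R * Num.sqrt (8 * ln (4 / delta)) + 4 / 3 * ln (4 / delta).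
have ln0 (a : R) : 1 < a -> 0 <= ln (a / delta).
  by move=> a1; rewrite ln_ge0// ler_pdivlMr// mul1r ltW// (lt_trans hdelta1).
have r10 : 0 <= r1.
  by rewrite addr_ge0 ?mulr_ge0 ?addr_ge0 ?mulr_ge0 ?sqrtr_ge0 ?ln0 ?ltr1n.
have r20 : 0 <= r2 by rewrite addr_ge0 ?mulr_ge0 ?sqrtr_ge0 ?ln0 ?ltr1n.
have boundE : bound = (r2 + r1) / k%:R.
  have sk : k%:R = Num.sqrt k%:R ^+ 2 :> R by rewrite sqr_sqrtr ?ltW.
  rewrite /bound /r1 /r2; move: sp sk; set s := Num.sqrt k%:R => sp ->.
  by field; rewrite gt_eqF.
have mgood : measurable good.
  have mW := measurable_covariance_dist hdot hsep hB hX hcopies hsigma htail.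
  have := mW measurableT _ (measurable_itv `]-oo, bound]%R).
  by rewrite setTI preimage_itvNyc.
pose N1 w := hs_norm B (covariance_deviation dot B P X X_ t w).
pose N2 w := `|exceedance_count X_ t w - k%:R|.
have [lam1 hl1 e1] := deviation_exponent kp hdelta0 hdelta1.
have [lam2 hl2 e2] := count_exponent kp hdelta0 hdelta1.
have [mN1 mgf1] := covariance_mgf hdot hsep hB hX hcopies n0 htail hl1.
have mgf2 := count_mgf hX hcopies n0 htail hl2.
have mN2 : measurable_fun setT N2.
  apply: measurableT_comp => //; apply: measurable_funB => //.
  exact: (measurable_count hcopies).
have /andP[l10 _] := hl1; have /andP[l20 _] := hl2.
have c1 := cosh_chernoff mN1 (fun w => hs_norm_ge0 B _) l10 r10 mgf1.
have c2 := cosh_chernoff mN2 (fun w => normr_ge0 _) l20 r20 mgf2.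
have mA1 : measurable [set w | r1 < N1 w].
  by have := mN1 measurableT _ (measurable_itv `]r1, +oo[%R); rewrite setTI preimage_itvoy.
have mA2 : measurable [set w | r2 < N2 w].
  by have := mN2 measurableT _ (measurable_itv `]r2, +oo[%R); rewrite setTI preimage_itvoy.
have bad : (P (~` good) < delta%:E)%E.
  apply: (@le_lt_trans _ _ (P ([set w | r1 < N1 w] `|` [set w | r2 < N2 w]))).
    apply: le_measure; rewrite ?inE//.
    - exact: measurableC.
    - exact: measurableU.
    - move=> w /= ngood; apply: contrapT => /not_orP[/negP]; rewrite -leNgt => h1.
      move=> /negP; rewrite -leNgt => h2; apply: ngood.
      have h := covariance_dist hdot hsep hB hX hkn hsigma htail w.
      by rewrite /good/=; apply: (le_trans h); rewrite boundE ler_wpM2r ?invr_ge0// lerD.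
  apply: (le_lt_trans (measureU2 P mA1 mA2)).
  have A2le : (P [set w | r2 < N2 w]%R <= (delta / 2)%:E)%E.
    by apply: le_trans c2 _; rewrite lee_fin.
  (* The strictness of the conclusion comes from this event. *)
  have A1lt : (P [set w | r1 < N1 w]%R < (delta / 2)%:E)%E.
    by apply: le_lt_trans c1 _; rewrite lte_fin.
  rewrite [delta in ltRHS](splitr delta) EFinD; apply: lte_leD => //.
  exact: fin_num_measure.
have fgood : P good \is a fin_num by exact: fin_num_measure.
move: bad; rewrite probability_setC// -(fineK fgood) -EFinB !lte_fin; lra.
Qed.
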